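(* Let $m,n\ge 2$, $m\ne n$, and let $\Pi$ be an arbitrary simple root system of the affine Lie superalgebra $\widehat{sl}(m|n)$. Then the affine super Yangian $Y_{\hbar}(\widehat{sl}(m|n,\Pi))$ (minimalistic presentation, generated by $x^\pm_{i,r},h_{i,r}$ with $r\in\{0,1\}$) is isomorphic, as an associative superalgebra, to the Drinfeld super Yangian $Y^D_{\hbar}(\widehat{sl}(m|n,\Pi))$ (generated by $x^\pm_{i,r},h_{i,r}$ with $r\in\mathbb{Z}_{\ge0}$).
   Context: Root data. Let $N=m+n$, $I=\{0,1,\dots,N-1\}$, indices read modulo $N$. Let $\varepsilon_1,\dots,\varepsilon_m,\delta_1,\dots,\delta_n$ be symbols with $(\varepsilon_i,\varepsilon_j)=\delta_{ij}$, $(\delta_i,\delta_j)=-\delta_{ij}$, $(\varepsilon_i,\delta_j)=0$, and let $\kappa$ be the null imaginary root, orthogonal to everything. A simple root system is a labelled set $\Pi=\{\alpha_0,\dots,\alpha_{N-1}\}$ with $\alpha_i=e_i-e_{i+1}$ for $1\le i\le N-1$ and $\alpha_0=\kappa+e_N-e_1$, where $(e_1,\dots,e_N)$ is, up to adding integer multiples of $\kappa$ to its entries, an ordering of $\varepsilon_1,\dots,\varepsilon_m,\delta_1,\dots,\delta_n$. A simple root is even if the two symbols in it are of the same type ($\varepsilon$ or $\delta$), odd otherwise. The Cartan matrix is $a_{ij}=(\alpha_i,\alpha_j)$. Superbrackets: $[a,b]=ab-(-1)^{p(a)p(b)}ba$, $\{a,b\}=ab+(-1)^{p(a)p(b)}ba$.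 In both algebras below $h_{i,r}$ is even and $x^\pm_{i,r}$ has the parity of $\alpha_i$. Minimalistic presentation. $Y_{\hbar}(\widehat{sl}(m|n,\Pi))$ is the unital associative superalgebra over $\mathbb{C}[\hbar]$ generated by $x^{\pm}_{i,r},h_{i,r}$ ($i\in I$, $r\in\{0,1\}$) subject to, with $\tilde h_{i,1}=h_{i,1}-\frac{\hbar}{2}h_{i,0}^2$ (all $i,j\in I$, $r,s\in\{0,1\}$): $[h_{i,r},h_{j,s}]=0$; $[x^+_{i,0},x^-_{j,0}]=\delta_{ij}h_{i,0}$; $[x^+_{i,1},x^-_{j,0}]=\delta_{ij}h_{i,1}=[x^+_{i,0},x^-_{j,1}]$; $[h_{i,0},x^\pm_{j,r}]=\pm a_{ij}x^\pm_{j,r}$; $[x^\pm_{i,1},x^\pm_{j,0}]-[x^\pm_{i,0},x^\pm_{j,1}]=\pm\frac{\hbar a_{ij}}{2}\{x^\pm_{i,0},x^\pm_{j,0}\}$; $[\tilde h_{i,1},x^\pm_{j,0}]=\pm a_{ij}x^\pm_{j,1}$; $(\mathrm{ad}\,x^\pm_{i,0})^{1+|a_{ij}|}(x^\pm_{j,0})=0$ for $i\ne j$; and for odd $\alpha_i$: $[x^\pm_{i,0},x^\pm_{i,0}]=0$ and $[[x^\pm_{i-1,0},x^\pm_{i,0}],[x^\pm_{i,0},x^\pm_{i+1,0}]]=0$. Drinfeld presentation. $Y^D_{\hbar}(\widehat{sl}(m|n,\Pi))$ is the unital associative superalgebra over $\mathbb{C}[\hbar]$ generated by $x^{\pm}_{i,r},h_{i,r}$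 ($i\in I$, $r\in\mathbb{Z}_{\ge0}$) subject to (all $i,j\in I$, $r,s\ge0$): $[h_{i,r},h_{j,s}]=0$; $[h_{i,0},x^\pm_{j,s}]=\pm a_{ij}x^\pm_{j,s}$; $[x^+_{i,r},x^-_{j,s}]=\delta_{ij}h_{i,r+s}$; $[h_{i,r+1},x^\pm_{j,s}]-[h_{i,r},x^\pm_{j,s+1}]=\pm\frac{\hbar a_{ij}}{2}\{h_{i,r},x^\pm_{j,s}\}$; $[x^\pm_{i,r+1},x^\pm_{j,s}]-[x^\pm_{i,r},x^\pm_{j,s+1}]=\pm\frac{\hbar a_{ij}}{2}\{x^\pm_{i,r},x^\pm_{j,s}\}$; for $i\ne j$ and $q=1+|a_{ij}|$, $\sum_{\sigma\in S_q}[x^\pm_{i,r_{\sigma(1)}},[x^\pm_{i,r_{\sigma(2)}},\dots,[x^\pm_{i,r_{\sigma(q)}},x^\pm_{j,s}]\dots]]=0$ for all $r_1,\dots,r_q,s\ge0$; and for odd $\alpha_i$: $[x^\pm_{i,r},x^\pm_{i,s}]=0$ and $[[x^\pm_{i-1,r},x^\pm_{i,0}],[x^\pm_{i,0},x^\pm_{i+1,s}]]=0$. *)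

(* Defs.v *)
From HB Require Import structures.
From mathcomp Require Import all_boot all_order all_algebra all_fingroup.
From mathcomp Require Import generic_quotient ring_quotient.
From mathcomp Require Import finmap monalg.
From mathcomp Require Import boolp reals complex.

Set Implicit Arguments.
Unset Strict Implicit.
Unset Printing Implicit Defensive.

Import GRing.Theory.
Local Open Scope ring_scope.

(* Associative superalgebras over R, that is Z/2-graded R-algebras; [spart p]
   is the projection onto the component of parity p (false = even). *)
HB.mixin Record Algebra_isSuperAlgebra (R : comNzRingType) A
    of GRing.Algebra R A := {
  spart : bool -> A -> A;
  spart_linear : forall p, linear (spart p);
  spartK : forall p q a, spart p (spart q a) = if p == q then spart q a else 0;
  spart_sum : forall a, spart false a + spart true a = a;
  spart_one : spart false 1 = 1;
  spart_mul : forall p q a b,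
    spart (p (+) q) (spart p a * spart q b) = spart p a * spart q b
}.

#[short(type="superAlgType")]
HB.structure Definition SuperAlgebra (R : comNzRingType) :=
  {A of Algebra_isSuperAlgebra R A & GRing.Algebra R A}.

Section SuperAlgebraDefs.
Variables (R : comNzRingType) (A : superAlgType R).
Implicit Types (a b : A) (p q : bool).

Definition homog p a : Prop := spart p a = a.

Definition sbracket a b : A :=
  \sum_(p : bool) \sum_(q : bool)
    (spart p a * spart q b - (-1) ^+ (p && q) * (spart q b * spart p a)).

Definition santibracket a b : A :=
  \sum_(p : bool) \sum_(q : bool)
    (spart p a * spart q b + (-1) ^+ (p && q) * (spart q b * spart p a)).

End SuperAlgebraDefs.

Definition superalg_isomorphic (R : comNzRingType) (A B : superAlgType R) :=
  exists f : {lrmorphism A -> B},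
    bijective f /\ forall p a, f (spart p a) = spart p (f a).

Section SuperAlgebraTheory.
Variables (R : comNzRingType) (A : superAlgType R).
Implicit Types (a b : A) (p q : bool).

HB.instance Definition _ p :=
  GRing.isLinear.Build R A A *:%R (@spart R A p) (@spart_linear R A p).

Lemma homog_spart p a : homog p (spart p a).
Proof. by rewrite /homog spartK eqxx. Qed.

Lemma homog_partE p q a : homog p a -> spart q a = if q == p then a else 0.
Proof. by move=> ha; rewrite -ha spartK ha. Qed.

Lemma homog0 p : homog p (0 : A).
Proof. by rewrite /homog linear0. Qed.

Lemma homog1 : homog false (1 : A).
Proof. exact: spart_one. Qed.

Lemma homogD p a b : homog p a -> homog p b -> homog p (a + b).
Proof. by rewrite /homog linearD /= => -> ->. Qed.

Lemma homogZ p c a : homog p a -> homog p (c *: a).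
Proof. by rewrite /homog linearZ /= => ->. Qed.

Lemma homogN p a : homog p a -> homog p (- a).
Proof. by rewrite -scaleN1r; apply: homogZ. Qed.

Lemma homogB p a b : homog p a -> homog p b -> homog p (a - b).
Proof. by move=> ha hb; apply: homogD ha (homogN hb). Qed.

Lemma homogM p q a b : homog p a -> homog q b -> homog (p (+) q) (a * b).
Proof. by move=> ha hb; rewrite /homog -ha -hb spart_mul. Qed.

Lemma homog_sum (I : Type) (r : seq I) (P : pred I) (F : I -> A) p :
  (forall i, P i -> homog p (F i)) -> homog p (\sum_(i <- r | P i) F i).
Proof.
by move=> h; elim/big_rec: _ => [|i x Pi]; [apply: homog0 | apply/homogD/h].
Qed.

Lemma homog_sign p (k : bool) a : homog p a -> homog p ((-1) ^+ k * a).
Proof. by move=> ha; rewrite mulr_sign; case: ifP => // _; apply: homogN. Qed.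

Lemma sbracketE p q a b : homog p a -> homog q b ->
  sbracket a b = a * b - (-1) ^+ (p && q) * (b * a).
Proof.
move=> ha hb; rewrite /sbracket !big_bool /=.
rewrite !(homog_partE _ ha) !(homog_partE _ hb).
by case: p ha => ha; case: q hb => hb /=;
   rewrite ?(mul0r, mulr0, oppr0, addr0, add0r).
Qed.

Lemma santibracketE p q a b : homog p a -> homog q b ->
  santibracket a b = a * b + (-1) ^+ (p && q) * (b * a).
Proof.
move=> ha hb; rewrite /santibracket !big_bool /=.
rewrite !(homog_partE _ ha) !(homog_partE _ hb).
by case: p ha => ha; case: q hb => hb /=;
   rewrite ?(mul0r, mulr0, addr0, add0r).
Qed.

Lemma homog_sbracket p q a b :
  homog p a -> homog q b -> homog (p (+) q) (sbracket a b).
Proof.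
move=> ha hb; rewrite (sbracketE ha hb).
apply: homogB; first exact: homogM.
by apply: homog_sign; rewrite addbC; apply: homogM.
Qed.

Lemma homog_santibracket p q a b :
  homog p a -> homog q b -> homog (p (+) q) (santibracket a b).
Proof.
move=> ha hb; rewrite (santibracketE ha hb).
apply: homogD; first exact: homogM.
by apply: homog_sign; rewrite addbC; apply: homogM.
Qed.

End SuperAlgebraTheory.

(* Free superalgebras, as monoid algebras of free monoids. *)
Record superGens := SuperGens { gsort :> choiceType; gpar : gsort -> bool }.

Definition wpar (X : superGens) (w : {fmonom X}) : bool :=
  \big[addb/false]_(x <- (w : seq X)) gpar x.

Definition freeSAlg (R : comNzRingType) (X : superGens) : Type :=
  {malg R[{fmonom X}]}.

Section FreeSuperAlgebra.
Variables (R : comNzRingType) (X : superGens).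
Local Notation F := (freeSAlg R X).

HB.instance Definition _ := GRing.Lalgebra.on F.

Fact free_scalerAr (c : R) (u v : {malg R[{fmonom X}]}) : c *: (u * v) = u * (c *: v).
Proof.
apply/malgP => k; rewrite mcoeffZ; apply: etrans (congr1 ( *%R c) (mcoeffMl u v k)) _.
rewrite (@mcoeffMlw _ _ _ _ _ _ _ (fsubset_refl _) (msuppZ_le c v)) mulr_sumr.
apply: eq_bigr => i _; rewrite mulr_sumr; apply: eq_bigr => j _.
by rewrite mcoeffZ mulrnAr mulrCA.
Qed.

HB.instance Definition _ := GRing.Lalgebra_isAlgebra.Build R F free_scalerAr.

Definition free_gen (x : X) : F := mkmalgU (fmu x) 1.

Definition free_part (p : bool) (g : F) : F :=
  [malg k in msupp g => if wpar k == p then mcoeff k g else 0].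

Lemma free_part_coeff p (g : F) (k : {fmonom X}) :
  mcoeff k (free_part p g) = if wpar k == p then mcoeff k g else 0.
Proof. by rewrite mcoeffE; case: (msuppP g k); rewrite ?if_same. Qed.

Fact free_part_linear p : linear (free_part p).
Proof.
move=> c u v; apply/malgP => k.
rewrite !(mcoeffD, mcoeffZ, free_part_coeff).
by case: ifP => _; rewrite ?mulr0 ?addr0.
Qed.

Fact free_partK p q (a : F) :
  free_part p (free_part q a) = if p == q then free_part q a else 0.
Proof.
apply/malgP => k; rewrite !free_part_coeff (fun_if (mcoeff k)).
rewrite free_part_coeff mcoeff0.
by case: (wpar k); case: p; case: q.
Qed.

Fact free_part_sum (a : F) : free_part false a + free_part true a = a.
Proof.
apply/malgP => k; rewrite mcoeffD !free_part_coeff.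
by case: (wpar k); rewrite /= ?add0r ?addr0.
Qed.

Lemma wparM (k l : {fmonom X}) : wpar (mmul k l) = wpar k (+) wpar l.
Proof. by rewrite /wpar /mmul /= fmmulE big_cat. Qed.

Lemma wpar1 : wpar (mone : {fmonom X}) = false.
Proof. by rewrite /wpar fm1 big_nil. Qed.

Fact free_part1 : free_part false 1 = 1.
Proof.
apply/malgP => k; rewrite free_part_coeff mcoeff1.
by case: eqP => //; have [->|_] := eqVneq k mone; rewrite ?wpar1.
Qed.

Fact free_partM p q (a b : F) :
  free_part (p (+) q) (free_part p a * free_part q b) =
  free_part p a * free_part q b.
Proof.
apply/malgP => k; rewrite free_part_coeff; case: eqP => // /eqP ne.
rewrite mcoeffMl big1 // => i _; rewrite big1 // => j _.
rewrite !free_part_coeff; case: eqP => [pi|]; last by rewrite mul0r mul0rn.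
case: eqP => [qj|]; last by rewrite mulr0 mul0rn.
case: eqP => [ij|]; last by rewrite mulr0n.
by case/negP: ne; rewrite -ij wparM pi qj.
Qed.

HB.instance Definition _ := Algebra_isSuperAlgebra.Build R F
  free_part_linear free_partK free_part_sum free_part1 free_partM.

Lemma homog_gen x : homog (gpar x) (free_gen x).
Proof.
rewrite /homog; apply/malgP => k; rewrite free_part_coeff mcoeffU.
have [<-|_] := eqVneq (fmu x) k; last by rewrite mulr0n if_same.
by rewrite /wpar fmuE big_seq1 eqxx.
Qed.

(* Augmentation: the constant term. *)
Definition augm (g : F) : R := mcoeff (mone : {fmonom X}) g.

HB.instance Definition _ := GRing.RMorphism.copy augm
  (@mcoeff {fmonom X} R (mone : {fmonom X})).

Lemma augm_gen x : augm (free_gen x) = 0.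
Proof.
rewrite /augm mcoeffU; case: eqP => // /(congr1 (fun w : {fmonom X} => seq.size w)).
by rewrite fmuE fm1.
Qed.

End FreeSuperAlgebra.
(* Two-sided ideal generated by the differences u - v: finite sums of
   products a * (u - v) * b. *)
Inductive rel_ideal (A : nzRingType) (rel : A -> A -> Prop) : A -> Prop :=
| RelIdeal0 : rel_ideal rel 0
| RelIdealD a b u v z :
    rel u v -> rel_ideal rel z -> rel_ideal rel (a * (u - v) * b + z).

Section RelIdeal.
Variables (A : nzRingType) (rel : A -> A -> Prop).
Local Notation I := (rel_ideal rel).

Lemma rel_ideal_add x y : I x -> I y -> I (x + y).
Proof.
by move=> Ix Iy; elim: Ix => [|a b u v z r _ IH];
   rewrite ?add0r // -addrA; apply: RelIdealD.
Qed.

Lemma rel_ideal_mull c x : I x -> I (c * x).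
Proof.
elim=> [|a b u v z r _ IH]; first by rewrite mulr0; apply: RelIdeal0.
by rewrite mulrDr 2!mulrA; apply: RelIdealD.
Qed.

Lemma rel_ideal_mulr c x : I x -> I (x * c).
Proof.
elim=> [|a b u v z r _ IH]; first by rewrite mul0r; apply: RelIdeal0.
by rewrite mulrDl -mulrA; apply: RelIdealD.
Qed.

Lemma rel_ideal_opp x : I x -> I (- x).
Proof. by rewrite -mulN1r; apply: rel_ideal_mull. Qed.

Lemma rel_ideal_rel u v : rel u v -> I (u - v).
Proof.
move=> r; have := RelIdealD 1 1 r (RelIdeal0 rel).
by rewrite mul1r mulr1 addr0.
Qed.

End RelIdeal.

Lemma rel_ideal_spart (R : comNzRingType) (A : superAlgType R)
    (rel : A -> A -> Prop) p a :
  (forall u v, rel u v -> exists q, homog q u /\ homog q v) ->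
  rel_ideal rel a -> rel_ideal rel (spart p a).
Proof.
move=> rel_homog; elim=> [|b c u v z r _ IH].
  by rewrite linear0; apply: RelIdeal0.
rewrite linearD /=; apply: rel_ideal_add => //.
have [d [hu hv]] := rel_homog _ _ r; have hw := homogB hu hv.
have Iw : rel_ideal rel (u - v) by apply: rel_ideal_rel.
move: (u - v) hw Iw => w hw Iw.
have key q1 q2 : rel_ideal rel (spart p (spart q1 b * w * spart q2 c)).
  rewrite (homog_partE _ (homogM (homogM (homog_spart q1 b) hw)
    (homog_spart q2 c))); case: ifP => _; last exact: RelIdeal0.
  by apply: rel_ideal_mulr; apply: rel_ideal_mull.
rewrite -(spart_sum b) -(spart_sum c) mulrDl mulrDr !(mulrDl _ _ (spart _ c)).
by do !rewrite linearD /=; do !apply: rel_ideal_add.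
Qed.

(* Relations between elements of a superalgebra, [hrel u v] being read u = v.
   Their homogeneity makes the quotient graded; properness makes it nontrivial,
   as required by [algType]. *)
Record homogRel (R : comNzRingType) (A : superAlgType R) := HomogRel {
  hrel :> A -> A -> Prop;
  hrel_homog : forall u v, hrel u v -> exists p, homog p u /\ homog p v;
  hrel_proper : ~ rel_ideal hrel 1
}.

Section SuperQuotient.
Variables (R : comNzRingType) (A : superAlgType R) (r : homogRel A).
Local Notation I := (rel_ideal r).

Definition qideal : {pred A} := fun a => `[< I a >].

Fact qideal_zmod_closed : zmod_closed qideal.
Proof.
split=> [|x y /asboolP Ix /asboolP Iy]; apply/asboolP; first exact: RelIdeal0.
by apply: rel_ideal_add => //; apply: rel_ideal_opp.
Qed.

HB.instance Definition _ :=
  GRing.isZmodClosed.Build A qideal qideal_zmod_closed.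

Definition superQuot : Type := {ideal_quot qideal}.

HB.instance Definition _ := GRing.Zmodule.on superQuot.

Definition qpi (a : A) : superQuot := \pi_({ideal_quot qideal})%qT a.
Definition qrepr (x : superQuot) : A := repr x.

Lemma qreprK : cancel qrepr qpi. Proof. exact: reprK. Qed.

Lemma qpiP a b : qpi a = qpi b <-> I (a - b).
Proof.
rewrite /qpi; split=> [/eqP|Iab].
  by rewrite -Quotient.idealrBE => /asboolP.
by apply/eqP; rewrite -Quotient.idealrBE; apply/asboolP.
Qed.

Lemma qpi_rel u v : r u v -> qpi u = qpi v.
Proof. by move=> uv; apply/qpiP/rel_ideal_rel. Qed.

Lemma qpi0 : qpi 0 = 0. Proof. by rewrite /qpi raddf0. Qed.
Lemma qpiD a b : qpi (a + b) = qpi a + qpi b.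
Proof. by rewrite /qpi raddfD. Qed.

Lemma qrepr_qpi a : I (qrepr (qpi a) - a).
Proof. by apply/qpiP; rewrite qreprK. Qed.

Definition qone : superQuot := qpi 1.
Definition qmul (x y : superQuot) : superQuot := qpi (qrepr x * qrepr y).
Definition qscale (c : R) (x : superQuot) : superQuot := qpi (c *: qrepr x).
Definition qpart (p : bool) (x : superQuot) : superQuot :=
  qpi (spart p (qrepr x)).

Lemma qmulE a b : qmul (qpi a) (qpi b) = qpi (a * b).
Proof.
apply/qpiP; set a' := qrepr _; set b' := qrepr _.
have -> : a' * b' - a * b = (a' - a) * b' + a * (b' - b).
  by rewrite mulrBl mulrBr addrA subrK.
apply: rel_ideal_add.
  by apply: rel_ideal_mulr; apply: qrepr_qpi.
by apply: rel_ideal_mull; apply: qrepr_qpi.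
Qed.

Lemma qscaleE c a : qscale c (qpi a) = qpi (c *: a).
Proof.
apply/qpiP; rewrite -scalerBr -[_ - a]mul1r scalerAl.
by apply: rel_ideal_mull; apply: qrepr_qpi.
Qed.

Lemma qideal_spart p a : I a -> I (spart p a).
Proof. by apply: rel_ideal_spart; apply: hrel_homog. Qed.

Lemma qpartE p a : qpart p (qpi a) = qpi (spart p a).
Proof.
by apply/qpiP; rewrite -linearB; apply: qideal_spart; apply: qrepr_qpi.
Qed.

Let qpiE := (qmulE, qscaleE, qpartE).

Fact qmulA : associative qmul.
Proof.
by move=> x y z; rewrite -[x]qreprK -[y]qreprK -[z]qreprK !qpiE mulrA.
Qed.
Fact qmul1l : left_id qone qmul.
Proof. by move=> x; rewrite -[x]qreprK !qpiE mul1r. Qed.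
Fact qmul1r : right_id qone qmul.
Proof. by move=> x; rewrite -[x]qreprK !qpiE mulr1. Qed.
Fact qmulDl : left_distributive qmul +%R.
Proof.
move=> x y z; rewrite -[x]qreprK -[y]qreprK -[z]qreprK.
by rewrite -qpiD !qpiE -qpiD mulrDl.
Qed.
Fact qmulDr : right_distributive qmul +%R.
Proof.
move=> x y z; rewrite -[x]qreprK -[y]qreprK -[z]qreprK.
by rewrite -qpiD !qpiE -qpiD mulrDr.
Qed.
Fact qone_neq0 : qone != 0.
Proof.
by apply/eqP; rewrite -qpi0 => /qpiP; rewrite subr0; apply: hrel_proper.
Qed.

HB.instance Definition _ := GRing.Zmodule_isNzRing.Build superQuot
  qmulA qmul1l qmul1r qmulDl qmulDr qone_neq0.

Fact qscaleA a b x : qscale a (qscale b x) = qscale (a * b) x.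
Proof. by rewrite -[x]qreprK !qpiE scalerA. Qed.
Fact qscale1 : left_id 1 qscale.
Proof. by move=> x; rewrite -[x]qreprK !qpiE scale1r. Qed.
Fact qscaleDr : right_distributive qscale +%R.
Proof.
move=> c x y; rewrite -[x]qreprK -[y]qreprK.
by rewrite -qpiD !qpiE -qpiD scalerDr.
Qed.
Fact qscaleDl x : {morph qscale^~ x : a b / a + b}.
Proof. by move=> a b; rewrite -[x]qreprK /= !qpiE -qpiD scalerDl. Qed.

HB.instance Definition _ := GRing.Zmodule_isLmodule.Build R superQuot
  qscaleA qscale1 qscaleDr qscaleDl.

Fact qscaleAl (c : R) (x y : superQuot) : c *: (x * y) = (c *: x) * y.
Proof.
rewrite -[x]qreprK -[y]qreprK.
by rewrite /GRing.mul /GRing.scale /= !qpiE scalerAl.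
Qed.
Fact qscaleAr (c : R) (x y : superQuot) : c *: (x * y) = x * (c *: y).
Proof.
rewrite -[x]qreprK -[y]qreprK.
by rewrite /GRing.mul /GRing.scale /= !qpiE scalerAr.
Qed.

HB.instance Definition _ :=
  GRing.Lmodule_isLalgebra.Build R superQuot qscaleAl.
HB.instance Definition _ :=
  GRing.Lalgebra_isAlgebra.Build R superQuot qscaleAr.

Fact qpi_linear : linear qpi.
Proof. by move=> c a b; rewrite qpiD -qscaleE. Qed.
Fact qpi_monoid_morphism : monoid_morphism qpi.
Proof. by split=> // a b; rewrite -qmulE. Qed.

HB.instance Definition _ := GRing.isLinear.Build R A superQuot *:%R qpi
  qpi_linear.
HB.instance Definition _ := GRing.isMonoidMorphism.Build A superQuot qpi
  qpi_monoid_morphism.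

Fact qpart_linear p : linear (qpart p).
Proof.
move=> c x y; rewrite -[x]qreprK -[y]qreprK.
have E a b : c *: qpi a + qpi b = qpi (c *: a + b) by rewrite qpi_linear.
rewrite (E (qrepr x) (qrepr y)) !qpartE spart_linear; exact: esym (E _ _).
Qed.
Fact qpartK p q x : qpart p (qpart q x) = if p == q then qpart q x else 0.
Proof.
by rewrite -[x]qreprK !qpartE spartK; case: ifP; rewrite ?qpi0.
Qed.
Fact qpart_sum x : qpart false x + qpart true x = x.
Proof. by rewrite -[x]qreprK !qpartE -qpiD spart_sum. Qed.
Fact qpart1 : qpart false 1 = 1.
Proof. by rewrite -[1](rmorph1 qpi) qpartE spart_one. Qed.
Fact qpartM p q x y :
  qpart (p (+) q) (qpart p x * qpart q y) = qpart p x * qpart q y.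
Proof.
have E a b : qpi a * qpi b = qpi (a * b) by exact: qmulE.
rewrite -[x]qreprK -[y]qreprK (qpartE p (qrepr x)) (qpartE q (qrepr y)).
by rewrite (E (spart p (qrepr x)) (spart q (qrepr y))) qpartE spart_mul.
Qed.

HB.instance Definition _ := Algebra_isSuperAlgebra.Build R superQuot
  qpart_linear qpartK qpart_sum qpart1 qpartM.

Lemma spart_qpi p a : spart p (qpi a) = qpi (spart p a).
Proof. exact: qpartE. Qed.

End SuperQuotient.

(* Relations without constant terms present a nontrivial algebra. *)
Lemma free_rel_proper (R : comNzRingType) (X : superGens)
    (rel : freeSAlg R X -> freeSAlg R X -> Prop) :
  (forall u v, rel u v -> augm u = 0 /\ augm v = 0) -> ~ rel_ideal rel 1.
Proof.
move=> rel0 I1; have: forall a, rel_ideal rel a -> augm a = 0.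
  move=> a; elim=> [|b c u v z /rel0[u0 v0] _ IH]; first by rewrite rmorph0.
  by rewrite rmorphD !rmorphM rmorphB /= u0 v0 subrr mulr0 mul0r add0r.
by move/(_ _ I1)/eqP; rewrite rmorph1 oner_eq0.
Qed.

Section FreeBrackets.
Variables (R : comNzRingType) (X : superGens).
Implicit Types a b : freeSAlg R X.

Lemma augm_spart p a : augm a = 0 -> augm (spart p a) = 0.
Proof.
move=> a0; rewrite -[augm _]/(mcoeff _ (free_part p a)) free_part_coeff.
by rewrite [mcoeff _ _]a0 if_same.
Qed.

Lemma augmZ c a : augm a = 0 -> augm (c *: a) = 0.
Proof. by move=> a0; rewrite /augm mcoeffZ [mcoeff _ _]a0 mulr0. Qed.

Lemma augmD a b : augm a = 0 -> augm b = 0 -> augm (a + b) = 0.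
Proof. by move=> a0 b0; rewrite (rmorphD _ a b) /= a0 b0 addr0. Qed.

Lemma augmB a b : augm a = 0 -> augm b = 0 -> augm (a - b) = 0.
Proof. by move=> a0 b0; rewrite (rmorphB _ a b) /= a0 b0 subr0. Qed.

Lemma augmMl a b : augm a = 0 -> augm (a * b) = 0.
Proof. by move=> a0; rewrite (rmorphM _ a b) /= a0 mul0r. Qed.

Lemma augmMr a b : augm b = 0 -> augm (a * b) = 0.
Proof. by move=> b0; rewrite (rmorphM _ a b) /= b0 mulr0. Qed.

Lemma augm_sum (I : finType) (f : I -> freeSAlg R X) :
  (forall i, augm (f i) = 0) -> augm (\sum_i f i) = 0.
Proof. by move=> f0; rewrite raddf_sum /= big1. Qed.

Lemma augm_sbracket a b : augm a = 0 -> augm (sbracket a b) = 0.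
Proof.
move=> a0; apply: augm_sum => p; apply: augm_sum => q.
apply: augmB; first exact/augmMl/augm_spart.
exact/augmMr/augmMr/augm_spart.
Qed.

Lemma augm_santibracket a b : augm a = 0 -> augm (santibracket a b) = 0.
Proof.
move=> a0; apply: augm_sum => p; apply: augm_sum => q.
apply: augmD; first exact/augmMl/augm_spart.
exact/augmMr/augmMr/augm_spart.
Qed.

End FreeBrackets.

Section RootData.
Variables m n : nat.

(* [inl i] is epsilon_(i+1), [inr j] is delta_(j+1). *)
Definition symb : finType := ('I_m + 'I_n)%type.
Definition is_eps (t : symb) : bool := if t is inl _ then true else false.

(* The lattice spanned by the symbols and kappa (last component). *)
Definition weight : zmodType := ({ffun symb -> int} * int)%type.
Definition wsymb (t : symb) : weight := ([ffun t' => (t' == t)%:R], 0).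
Definition kappa : weight := (0, 1).

Definition wform (u v : weight) : int :=
  \sum_(t : symb) (if is_eps t then 1 else -1) * (u.1 t * v.1 t).

(* e_k is the symbol [rs_symb k] plus [rs_shift k] times kappa, where indices
   are read modulo N = m + n: e_N is stored at index 0. *)
Record simpleRootSystem := SimpleRootSystem {
  rs_symb : 'I_(m + n) -> symb;
  rs_symb_bij : bijective rs_symb;
  rs_shift : 'I_(m + n) -> int
}.

Variable Pi : simpleRootSystem.
Implicit Types i j : 'I_(m + n).

Definition rs_e i : weight := wsymb (rs_symb Pi i) + kappa *~ rs_shift Pi i.

Definition rs_root i : weight :=
  rs_e i - rs_e (ordS i) + (if val i == 0%N then kappa else 0).

Definition rs_odd i : bool :=
  is_eps (rs_symb Pi i) != is_eps (rs_symb Pi (ordS i)).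

Definition rs_cartan i j : int := wform (rs_root i) (rs_root j).

End RootData.

Section Generators.
Variables (K : fieldType) (m n : nat) (Pi : simpleRootSystem m n).
Variable L : choiceType.

(* [inl (s, i, r)] is x^+_{i,r} for s = false and x^-_{i,r} for s = true;
   [inr (i, r)] is h_{i,r}. *)
Definition ygen : choiceType :=
  ((bool * 'I_(m + n) * L) + ('I_(m + n) * L))%type.

Definition ypar (g : ygen) : bool :=
  if g is inl (_, i, _) then rs_odd Pi i else false.

Definition ygens : superGens := SuperGens ypar.

Definition yx (s : bool) (i : 'I_(m + n)) (r : L) : freeSAlg {poly K} ygens :=
  free_gen _ (inl (s, i, r) : ygens).
Definition yh (i : 'I_(m + n)) (r : L) : freeSAlg {poly K} ygens :=
  free_gen _ (inr (i, r) : ygens).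

Lemma homog_yx s i r : homog (rs_odd Pi i) (yx s i r).
Proof. exact: (homog_gen _ (inl (s, i, r) : ygens)). Qed.

Lemma homog_yh i r : homog false (yh i r).
Proof. exact: (homog_gen _ (inr (i, r) : ygens)). Qed.

Lemma augm_yx s i r : augm (yx s i r) = 0.
Proof. exact: augm_gen. Qed.

Lemma augm_yh i r : augm (yh i r) = 0.
Proof. exact: augm_gen. Qed.

(* The coefficients (+/-) a_ij and (+/-) hbar a_ij / 2, hbar being 'X. *)
Definition ycoef (s : bool) i j : {poly K} :=
  (-1) ^+ s * (rs_cartan Pi i j)%:~R.
Definition yhcoef (s : bool) i j : {poly K} := ycoef s i j * (2^-1 *: 'X).

End Generators.

Local Notation sb := sbracket.
Local Notation sa := santibracket.

Section MinimalisticPresentation.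
Variables (K : fieldType) (m n : nat) (Pi : simpleRootSystem m n).
Local Notation F := (freeSAlg {poly K} (ygens Pi 'I_2)).
Local Notation x := (@yx K m n Pi 'I_2).
Local Notation h := (@yh K m n Pi 'I_2).
Local Notation a := (rs_cartan Pi).

Definition yh1tilde (i : 'I_(m + n)) : F :=
  h i 1 - (2^-1 *: 'X) *: h i 0 ^+ 2.

Variant ymin_rel : F -> F -> Prop :=
| YMhh i j r s : ymin_rel (sb (h i r) (h j s)) 0
| YMx0x0 i j :
    ymin_rel (sb (x false i 0) (x true j 0)) (if i == j then h i 0 else 0)
| YMx1x0 i j :
    ymin_rel (sb (x false i 1) (x true j 0)) (if i == j then h i 1 else 0)
| YMx0x1 i j :
    ymin_rel (sb (x false i 0) (x true j 1)) (if i == j then h i 1 else 0)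
| YMh0x s i j r :
    ymin_rel (sb (h i 0) (x s j r)) (ycoef K Pi s i j *: x s j r)
| YMxx s i j :
    ymin_rel (sb (x s i 1) (x s j 0) - sb (x s i 0) (x s j 1))
             (yhcoef K Pi s i j *: sa (x s i 0) (x s j 0))
| YMh1x s i j :
    ymin_rel (sb (yh1tilde i) (x s j 0)) (ycoef K Pi s i j *: x s j 1)
| YMserre s i j : i != j ->
    ymin_rel (iter (1 + `|a i j|) (sb (x s i 0)) (x s j 0)) 0
| YModd s i : rs_odd Pi i ->
    ymin_rel (sb (x s i 0) (x s i 0)) 0
| YMquartic s i : rs_odd Pi i ->
    ymin_rel (sb (sb (x s (ord_pred i) 0) (x s i 0))
                 (sb (x s i 0) (x s (ordS i) 0))) 0.

Lemma homog_yh1tilde i : homog false (yh1tilde i).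
Proof.
apply: homogB; first exact: homog_yh.
by apply: homogZ; rewrite expr2; apply: (@homogM _ _ false false); apply: homog_yh.
Qed.

Lemma augm_yh1tilde i : augm (yh1tilde i) = 0.
Proof.
apply: augmB; first exact: augm_yh.
by apply: augmZ; rewrite expr2; apply: augmMl; apply: augm_yh.
Qed.

Fact ymin_homog u v :
  ymin_rel u v -> exists p, homog p u /\ homog p v.
Proof.
pose hx := (@homog_yx K m n Pi 'I_2); pose hh := (@homog_yh K m n Pi 'I_2).
have hd (i j : 'I_(m + n)) y : homog false y ->
    homog (rs_odd Pi i (+) rs_odd Pi j) (if i == j then y else 0 : F).
  by case: eqP => [->|_] hy; [rewrite addbb | apply: homog0].
case=> {u v} [i j r s|i j|i j|i j|s i j r|s i j|s i j|s i j _|s i _|s i _].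
- by eexists; split; [apply: (homog_sbracket (hh _ _) (hh _ _)) |
    apply: homog0].
- by eexists; split; [apply: (homog_sbracket (hx _ _ _) (hx _ _ _)) |
    apply/hd/hh].
- by eexists; split; [apply: (homog_sbracket (hx _ _ _) (hx _ _ _)) |
    apply/hd/hh].
- by eexists; split; [apply: (homog_sbracket (hx _ _ _) (hx _ _ _)) |
    apply/hd/hh].
- by eexists; split; [apply: (homog_sbracket (hh _ _) (hx _ _ _)) |
    apply/homogZ/hx].
- by eexists; split; [apply: homogB; apply: (homog_sbracket (hx _ _ _) (hx _ _ _))
    | apply/homogZ/(homog_santibracket (hx _ _ _) (hx _ _ _))].
- by eexists; split; [apply: (homog_sbracket (homog_yh1tilde _) (hx _ _ _)) |
    apply/homogZ/hx].
- have [p hp] : exists p,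
      homog p (iter (1 + `|a i j|) (sb (x s i 0)) (x s j 0)).
    elim: (1 + _)%N => [|k [p hp]]; first by exists (rs_odd Pi j); apply: hx.
    by eexists; apply: (homog_sbracket (hx _ _ _) hp).
  by exists p; split=> //; apply: homog0.
- by eexists; split; [apply: (homog_sbracket (hx _ _ _) (hx _ _ _)) |
    apply: homog0].
- by eexists; split; [apply: (homog_sbracket
    (homog_sbracket (hx _ _ _) (hx _ _ _))
    (homog_sbracket (hx _ _ _) (hx _ _ _))) | apply: homog0].
Qed.

Fact ymin_augm u v : ymin_rel u v -> augm u = 0 /\ augm v = 0.
Proof.
pose ax := (@augm_yx K m n Pi 'I_2); pose ah := (@augm_yh K m n Pi 'I_2).
have a0 : augm (0 : F) = 0 by exact: rmorph0.
have ad (i j : 'I_(m + n)) y : augm y = 0 ->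
    augm (if i == j then y else 0 : F) = 0.
  by case: eqP.
case=> {u v} [i j r s|i j|i j|i j|s i j r|s i j|s i j|s i j _|s i _|s i _].
- by split; [apply/augm_sbracket/ah | apply: a0].
- by split; [apply/augm_sbracket/ax | apply/ad/ah].
- by split; [apply/augm_sbracket/ax | apply/ad/ah].
- by split; [apply/augm_sbracket/ax | apply/ad/ah].
- by split; [apply/augm_sbracket/ah | apply/augmZ/ax].
- split; first by apply: augmB; apply/augm_sbracket/ax.
  by apply/augmZ/augm_santibracket/ax.
- by split; [apply/augm_sbracket/augm_yh1tilde | apply/augmZ/ax].
- by split; [apply/augm_sbracket/ax | apply: a0].
- by split; [apply/augm_sbracket/ax | apply: a0].
- by split; [apply/augm_sbracket/augm_sbracket/ax | apply: a0].
Qed.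

Definition ymin_homogRel : homogRel F :=
  HomogRel ymin_homog (free_rel_proper ymin_augm).

Definition superYangian : superAlgType {poly K} := superQuot ymin_homogRel.

End MinimalisticPresentation.

Section DrinfeldPresentation.
Variables (K : fieldType) (m n : nat) (Pi : simpleRootSystem m n).
Local Notation F := (freeSAlg {poly K} (ygens Pi nat)).
Local Notation x := (@yx K m n Pi nat).
Local Notation h := (@yh K m n Pi nat).
Local Notation a := (rs_cartan Pi).

Variant ydr_rel : F -> F -> Prop :=
| YDhh i j r s : ydr_rel (sb (h i r) (h j s)) 0
| YDh0x s i j r :
    ydr_rel (sb (h i 0%N) (x s j r)) (ycoef K Pi s i j *: x s j r)
| YDxx_h i j r t :
    ydr_rel (sb (x false i r) (x true j t)) (if i == j then h i (r + t)%N else 0)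
| YDhx s i j r t :
    ydr_rel (sb (h i r.+1) (x s j t) - sb (h i r) (x s j t.+1))
            (yhcoef K Pi s i j *: sa (h i r) (x s j t))
| YDxx s i j r t :
    ydr_rel (sb (x s i r.+1) (x s j t) - sb (x s i r) (x s j t.+1))
            (yhcoef K Pi s i j *: sa (x s i r) (x s j t))
| YDserre s i j (r : 'I_(1 + `|a i j|) -> nat) t : i != j ->
    ydr_rel (\sum_(sigma : 'S_(1 + `|a i j|))
               foldr (fun k y => sb (x s i (r (sigma k))) y) (x s j t)
                     (enum 'I_(1 + `|a i j|))) 0
| YDodd s i r t : rs_odd Pi i ->
    ydr_rel (sb (x s i r) (x s i t)) 0
| YDquartic s i r t : rs_odd Pi i ->
    ydr_rel (sb (sb (x s (ord_pred i) r) (x s i 0%N))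
                (sb (x s i 0%N) (x s (ordS i) t))) 0.

Fact ydr_homog u v : ydr_rel u v -> exists p, homog p u /\ homog p v.
Proof.
pose hx := (@homog_yx K m n Pi nat); pose hh := (@homog_yh K m n Pi nat).
case=> {u v} [i j r s|s i j r|i j r t|s i j r t|s i j r t|s i j r t _|s i r t _
  |s i r t _].
- by eexists; split; [apply: (homog_sbracket (hh _ _) (hh _ _)) |
    apply: homog0].
- by eexists; split; [apply: (homog_sbracket (hh _ _) (hx _ _ _)) |
    apply/homogZ/hx].
- eexists; split; first by apply: (homog_sbracket (hx _ _ _) (hx _ _ _)).
  by case: eqP => [->|_]; [rewrite addbb; apply: hh | apply: homog0].
- by eexists; split; [apply: homogB; apply: (homog_sbracket (hh _ _) (hx _ _ _))
    | apply/homogZ/(homog_santibracket (hh _ _) (hx _ _ _))].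
- by eexists; split; [apply: homogB; apply: (homog_sbracket (hx _ _ _) (hx _ _ _))
    | apply/homogZ/(homog_santibracket (hx _ _ _) (hx _ _ _))].
- exists (foldr (fun _ p => rs_odd Pi i (+) p) (rs_odd Pi j)
            (enum 'I_(1 + `|a i j|))).
  split; last exact: homog0.
  apply: homog_sum => sigma _; elim: (enum _) => [|k l IH] /=; first exact: hx.
  exact: (homog_sbracket (hx _ _ _) IH).
- by eexists; split; [apply: (homog_sbracket (hx _ _ _) (hx _ _ _)) |
    apply: homog0].
- by eexists; split; [apply: (homog_sbracket
    (homog_sbracket (hx _ _ _) (hx _ _ _))
    (homog_sbracket (hx _ _ _) (hx _ _ _))) | apply: homog0].
Qed.

Fact ydr_augm u v : ydr_rel u v -> augm u = 0 /\ augm v = 0.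
Proof.
pose ax := (@augm_yx K m n Pi nat); pose ah := (@augm_yh K m n Pi nat).
have a0 : augm (0 : F) = 0 by exact: rmorph0.
case=> {u v} [i j r s|s i j r|i j r t|s i j r t|s i j r t|s i j r t _|s i r t _
  |s i r t _].
- by split; [apply/augm_sbracket/ah | apply: a0].
- by split; [apply/augm_sbracket/ah | apply/augmZ/ax].
- split; first by apply/augm_sbracket/ax.
  by case: eqP => _; [apply: ah | apply: a0].
- split; first by apply: augmB; apply/augm_sbracket/ah.
  by apply/augmZ/augm_santibracket/ah.
- split; first by apply: augmB; apply/augm_sbracket/ax.
  by apply/augmZ/augm_santibracket/ax.
- split; last exact: a0.
  apply: augm_sum => sigma.
  by case: (enum _) => [|k l] /=; [apply: ax | apply/augm_sbracket/ax].
- by split; [apply/augm_sbracket/ax | apply: a0].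
- by split; [apply/augm_sbracket/augm_sbracket/ax | apply: a0].
Qed.

Definition ydr_homogRel : homogRel F :=
  HomogRel ydr_homog (free_rel_proper ydr_augm).

Definition drinfeldSuperYangian : superAlgType {poly K} :=
  superQuot ydr_homogRel.

End DrinfeldPresentation.

(* Main.v *)
From HB Require Import structures.
Require Import Defs.
From mathcomp Require Import all_boot all_order all_algebra all_fingroup.
From mathcomp Require Import finmap monalg.
From mathcomp Require Import reals complex.
From mathcomp Require Import ring zify.

Set Implicit Arguments.
Unset Strict Implicit.
Unset Printing Implicit Defensive.

Import GRing.Theory Num.Theory.
Local Open Scope ring_scope.

(** The theorem compares generators in degrees 0 and 1 with generators in all
    degrees. A homomorphism from the minimalistic to the Drinfeld algebra is
    clear. For the converse one constructs all [x s i r] inside the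
    minimalistic algebra and proves the Drinfeld relations there. Write
    [hbar = 2 eta].

    The elements [h i 1 - eta h i 0 ^ 2] commute with one another and send
    [x s j 0] to a multiple of [x s j 1], the factor being a Cartan matrix
    entry. Repeating this defines [x s j r] for all [r], independently of the
    chosen [i], and [h i r] is defined as the bracket of [x+ i r] with
    [x- i 0]. As [m <> n], every functional on the simple roots that kills the
    imaginary root is the pairing with an element of the root lattice, so
    there are even elements whose adjoint action raises the currents of one
    node and kills those of two other given nodes (raising_element). This
    spreads all relations between different nodes from degree 0 to all degrees
    (x_opposite_nodes, xx_relation_neq, current_relation_neq_plus).

    The core is that [[x+ i p, x- i q]] depends on [p + q] only (pairingE). If
    this holds up to total degree [r], the raising operators measure the next
    failure by a single element [E i]. The relations between [h k] and the
    currents of a neighbour [i] combine into a second-order recurrence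
    (comm_current_pairing), which gives [[h k r, h i 1] = r a_ki E i] and
    [[h i 1, h k r] = a_ik E k]. Hence [r E i = - E k]; by symmetry
    [(r ^ 2 - 1) E i = 0], so [E i = 0] for [r >= 2], while [r = 1] is covered
    by the commutation of the given Cartan elements.

    Relations inside one node [i] involve two equal current families, and the
    raising operator only yields their behaviour under [X + Y], where [X] and
    [Y] shift the two indices. The degree-2 current of a neighbour supplies
    [X ^ 2 + Y ^ 2] up to lower terms (second_shift). These generate the
    symmetric polynomials, and with the symmetry of the relation this suffices
    to descend from degree 0 (symmetric_family_eq0); the cubic Serre relations
    follow in the same way, with the other neighbour of [i]. The remaining
    relations of [h i] with the currents of [i] come from bracketing with
    currents of opposite charge (current_relation_self), the commutativity of
    the [h]'s again from the recurrence (currents_commute), and the quartic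
    relations from raising operators that fix the middle node.

    The two homomorphisms are inverse to each other on generators, because in
    the Drinfeld algebra [h i 1 - eta h i 0 ^ 2] raises the degree as well. *)

(** * Deciding identities in free algebras *)

(** Reified expressions of an algebra; the coefficients stay elements of the
    commutative ground ring, so that identities between them can be handed
    over to [ring]. *)
Inductive aexpr (R : Type) :=
| AAtom of nat
| AZero
| AOne
| AAdd of aexpr R & aexpr R
| AOpp of aexpr R
| AMul of aexpr R & aexpr R
| AScale of R & aexpr R.

Arguments AAtom {R}.
Arguments AZero {R}.
Arguments AOne {R}.

Section NoncommutativeNormalForm.
Variables (R : comNzRingType) (A : algType R).

Fixpoint aeval (env : seq A) (e : aexpr R) : A :=
  match e with
  | AAtom k => nth 0 env k
  | AZero => 0
  | AOne => 1
  | AAdd e1 e2 => aeval env e1 + aeval env e2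
  | AOpp e1 => - aeval env e1
  | AMul e1 e2 => aeval env e1 * aeval env e2
  | AScale c e1 => c *: aeval env e1
  end.

Fixpoint word_eval (env : seq A) (w : seq nat) : A :=
  if w is k :: w' then nth 0 env k * word_eval env w' else 1.

Fixpoint wpoly_eval (env : seq A) (l : seq (R * seq nat)) : A :=
  if l is cw :: l' then cw.1 *: word_eval env cw.2 + wpoly_eval env l' else 0.

(** The operations on words and polynomials are spelled out here, so that
    reducing exactly these constants normalizes an expression without touching
    its coefficients. *)
Fixpoint word_eqb (v w : seq nat) : bool :=
  match v, w with
  | [::], [::] => true
  | a :: v', b :: w' => if Nat.eqb a b then word_eqb v' w' else false
  | _, _ => false
  end.

Fixpoint app (T : Type) (s t : seq T) : seq T :=
  if s is a :: s' then a :: app s' t else t.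

Fixpoint wpoly_insert (c : R) (w : seq nat) (l : seq (R * seq nat)) :=
  match l with
  | [::] => [:: (c, w)]
  | (d, v) :: l' => if word_eqb w v then (c + d, v) :: l'
                    else (d, v) :: wpoly_insert c w l'
  end.

Fixpoint wpoly_add (k l : seq (R * seq nat)) :=
  if k is (c, w) :: k' then wpoly_insert c w (wpoly_add k' l) else l.

Fixpoint wpoly_mul1 (c : R) (w : seq nat) (l : seq (R * seq nat)) :=
  if l is (d, v) :: l' then
    (c * d, app w v) :: wpoly_mul1 c w l' else [::].

Fixpoint wpoly_mul (k l : seq (R * seq nat)) :=
  if k is (c, w) :: k' then wpoly_add (wpoly_mul1 c w l) (wpoly_mul k' l)
  else [::].

Fixpoint anorm (e : aexpr R) : seq (R * seq nat) :=
  match e with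
  | AAtom k => [:: (1, [:: k])]
  | AZero => [::]
  | AOne => [:: (1, [::])]
  | AAdd e1 e2 => wpoly_add (anorm e1) (anorm e2)
  | AOpp e1 => wpoly_mul1 (-1) [::] (anorm e1)
  | AMul e1 e2 => wpoly_mul (anorm e1) (anorm e2)
  | AScale c e1 => wpoly_mul1 c [::] (anorm e1)
  end.

Fixpoint all_zero (l : seq (R * seq nat)) : Prop :=
  match l with
  | [::] => True
  | [:: (c, _)] => c = 0
  | (c, _) :: l' => c = 0 /\ all_zero l'
  end.

Lemma word_eqbP v w : word_eqb v w -> v = w.
Proof.
elim: v w => [|a v IH] [|b w] //=.
by case: (PeanoNat.Nat.eqb_spec a b) => // -> /IH ->.
Qed.

Lemma word_eval_app env v w :
  word_eval env (app v w) = word_eval env v * word_eval env w.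
Proof. by elim: v => [|a v IH] /=; rewrite ?mul1r // IH mulrA. Qed.

Lemma wpoly_eval_insert env c w l :
  wpoly_eval env (wpoly_insert c w l)
  = c *: word_eval env w + wpoly_eval env l.
Proof.
elim: l => [|[d v] l IH] //=.
case: ifP => [/word_eqbP ->|_] /=; first by rewrite scalerDl addrA.
by rewrite IH addrCA.
Qed.

Lemma wpoly_eval_add env k l :
  wpoly_eval env (wpoly_add k l) = wpoly_eval env k + wpoly_eval env l.
Proof.
elim: k => [|[c w] k IH] /=; first by rewrite add0r.
by rewrite wpoly_eval_insert IH addrA.
Qed.

Lemma wpoly_eval_mul1 env c w l :
  wpoly_eval env (wpoly_mul1 c w l)
  = (c *: word_eval env w) * wpoly_eval env l.
Proof.
elim: l => [|[d v] l IH] /=; first by rewrite mulr0.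
by rewrite IH word_eval_app mulrDr -scalerAr -!scalerAl scalerA mulrC.
Qed.

Lemma wpoly_eval_mul env k l :
  wpoly_eval env (wpoly_mul k l) = wpoly_eval env k * wpoly_eval env l.
Proof.
elim: k => [|[c w] k IH] /=; first by rewrite mul0r.
by rewrite wpoly_eval_add wpoly_eval_mul1 IH mulrDl.
Qed.

Lemma anormE env e : wpoly_eval env (anorm e) = aeval env e.
Proof.
elim: e => [k|||e1 IH1 e2 IH2|e IH|e1 IH1 e2 IH2|c e IH] //=.
- by rewrite scale1r mulr1 addr0.
- by rewrite scale1r addr0.
- by rewrite wpoly_eval_add IH1 IH2.
- by rewrite wpoly_eval_mul1 /= scaleN1r mulN1r IH.
- by rewrite wpoly_eval_mul IH1 IH2.
- by rewrite wpoly_eval_mul1 /= -scalerAl mul1r IH.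
Qed.

Lemma all_zero_eval env l : all_zero l -> wpoly_eval env l = 0.
Proof.
elim: l => [|[c w] l IH] //= Z.
have [-> /IH ->] : c = 0 /\ all_zero l by case: l Z {IH} => [|d l].
by rewrite scale0r addr0.
Qed.

Lemma anorm_eq env e1 e2 :
  all_zero (anorm (AAdd e1 (AOpp e2))) -> aeval env e1 = aeval env e2.
Proof.
by move=> Z; apply/subr0_eq; rewrite -[RHS](all_zero_eval env Z) anormE.
Qed.

End NoncommutativeNormalForm.

Ltac alg_in x env :=
  lazymatch env with
  | @nil _ => constr:(false)
  | x :: _ => constr:(true)
  | _ :: ?env' => alg_in x env'
  end.

Ltac alg_index x env :=
  lazymatch env with
  | x :: _ => constr:(O)
  | _ :: ?env' => let k := alg_index x env' in constr:(S k)
  end.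

Ltac alg_env env x :=
  lazymatch x with
  | GRing.zero => env
  | GRing.one => env
  | GRing.add ?y ?z => let env' := alg_env env y in alg_env env' z
  | GRing.opp ?y => alg_env env y
  | GRing.mul ?y ?z => let env' := alg_env env y in alg_env env' z
  | GRing.scale _ ?y => alg_env env y
  | _ => lazymatch alg_in x env with
         | true => env
         | false => constr:(x :: env)
         end
  end.

Ltac alg_reify R env x :=
  lazymatch x with
  | GRing.zero => constr:(@AZero R)
  | GRing.one => constr:(@AOne R)
  | GRing.add ?y ?z =>
      let e1 := alg_reify R env y in let e2 := alg_reify R env z in
      constr:(@AAdd R e1 e2)
  | GRing.opp ?y => let e := alg_reify R env y in constr:(@AOpp R e)
  | GRing.mul ?y ?z =>
      let e1 := alg_reify R env y in let e2 := alg_reify R env z in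
      constr:(@AMul R e1 e2)
  | GRing.scale ?c ?y =>
      let e := alg_reify R env y in constr:(@AScale R c e)
  | _ => let k := alg_index x env in constr:(@AAtom R k)
  end.

(** Proves an equality that holds in every algebra: both sides are expanded
    into noncommutative monomials, and the coefficients are compared in the
    ground ring. *)
Ltac noncomm R A :=
  lazymatch goal with
  | |- @eq ?T ?x ?y =>
      let env1 := alg_env (@nil T) x in
      let env := alg_env env1 y in
      let e1 := alg_reify (GRing.ComNzRing.sort R) env x in
      let e2 := alg_reify (GRing.ComNzRing.sort R) env y in
      let H := fresh in
      have H := @anorm_eq R A env e1 e2;
      cbv [anorm wpoly_add wpoly_insert wpoly_mul1 wpoly_mul app word_eqb
           Nat.eqb all_zero aeval nth] in H;
      apply: H; repeat split; ring
  end.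

(** * Superbrackets *)

Section SuperbracketCalculus.
Variables (R : comNzRingType) (A : superAlgType R).
Implicit Types (a b t u v y : A) (p q : bool).

Local Notation sb := (@sbracket R A).
Local Notation sa := (@santibracket R A).

Lemma sbracketZE p q a b : homog p a -> homog q b ->
  sb a b = a * b - ((-1) ^+ (p && q) : R) *: (b * a).
Proof.
move=> ha hb; rewrite (sbracketE ha hb).
by case: (p && q); rewrite ?expr0 ?expr1 ?mul1r ?mulN1r ?scale1r ?scaleN1r.
Qed.

Lemma santibracketZE p q a b : homog p a -> homog q b ->
  sa a b = a * b + ((-1) ^+ (p && q) : R) *: (b * a).
Proof.
move=> ha hb; rewrite (santibracketE ha hb).
by case: (p && q); rewrite ?expr0 ?expr1 ?mul1r ?mulN1r ?scale1r ?scaleN1r.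
Qed.

Definition comm a b := a * b - b * a.

Lemma comm_is_linear t : linear (comm t).
Proof. move=> c a b; rewrite /comm; noncomm R A. Qed.

HB.instance Definition _ t :=
  GRing.isLinear.Build R A A *:%R (comm t) (comm_is_linear t).

Lemma commC a b : comm a b = - comm b a.
Proof. by rewrite /comm opprB. Qed.

Lemma comm_eq0 a b : a * b = b * a -> comm a b = 0.
Proof. by move=> ab; rewrite /comm ab subrr. Qed.

Lemma comm0_eq a b : comm a b = 0 -> a * b = b * a.
Proof. by move/subr0_eq. Qed.

Lemma commDl a b t : comm (a + b) t = comm a t + comm b t.
Proof. rewrite /comm; noncomm R A. Qed.

Lemma commZl (c : R) a t : comm (c *: a) t = c *: comm a t.
Proof. rewrite /comm; noncomm R A. Qed.

Lemma commDr t a b : comm t (a + b) = comm t a + comm t b.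
Proof. exact: linearD. Qed.

Lemma commBr t a b : comm t (a - b) = comm t a - comm t b.
Proof. exact: linearB. Qed.

Lemma commZr t (c : R) a : comm t (c *: a) = c *: comm t a.
Proof. exact: linearZ. Qed.

Lemma comm0r t : comm t 0 = 0.
Proof. exact: linear0. Qed.

Lemma comm_sumr (I : Type) (r : seq I) (F : I -> A) t :
  comm t (\sum_(i <- r) F i) = \sum_(i <- r) comm t (F i).
Proof. exact: linear_sum. Qed.

Lemma commMr t a b : comm t (a * b) = comm t a * b + a * comm t b.
Proof. rewrite /comm; noncomm R A. Qed.

Lemma comm_suml (I : Type) (r : seq I) (F : I -> A) t :
  comm (\sum_(i <- r) F i) t = \sum_(i <- r) comm (F i) t.
Proof. by rewrite /comm mulr_suml mulr_sumr sumrB. Qed.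

Lemma comm_jacobi a b t :
  comm a (comm b t) = comm (comm a b) t + comm b (comm a t).
Proof. rewrite /comm; noncomm R A. Qed.

Lemma comm_commute a b t :
  comm a b = 0 -> comm a (comm b t) = comm b (comm a t).
Proof.
by move=> ab; rewrite comm_jacobi ab {1}/comm mul0r mulr0 subrr add0r.
Qed.

Lemma comm_eigen_shift (c al : R) a b t u : comm a b = 0 ->
  comm a t = al *: u -> comm a (c *: comm b t) = al *: (c *: comm b u).
Proof.
by move=> ab abt; rewrite commZr comm_commute // abt commZr !scalerA mulrC.
Qed.

Lemma sbracket_even p a b : homog false a -> homog p b -> sb a b = comm a b.
Proof. by move=> ha hb; rewrite (sbracketZE ha hb) scale1r. Qed.

Lemma santibracket_even p a b :
  homog false a -> homog p b -> sa a b = a * b + b * a.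
Proof. by move=> ha hb; rewrite (santibracketZE ha hb) scale1r. Qed.

Lemma homog_comm p t y : homog false t -> homog p y -> homog p (comm t y).
Proof.
move=> ht hy; apply: homogB; first exact: (homogM ht hy).
by rewrite -[p]addbF; apply: (homogM hy ht).
Qed.

Lemma spart_comm p t y :
  homog false t -> spart p (comm t y) = comm t (spart p y).
Proof.
move=> ht; have h q := homog_comm ht (homog_spart q y).
have -> : comm t y = comm t (spart false y) + comm t (spart true y).
  by rewrite -linearD spart_sum.
rewrite linearD /= (homog_partE p (h false)) (homog_partE p (h true)).
by case: p; rewrite ?addr0 ?add0r.
Qed.

(** The adjoint action of an even element obeys the Leibniz rule without
    signs, and its arguments do not have to be homogeneous. *)
Lemma comm_sbracket t a b : homog false t ->
  comm t (sb a b) = sb (comm t a) b + sb a (comm t b).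
Proof.
move=> ht; rewrite /sbracket !big_bool /= !spart_comm //.
rewrite ?expr0 ?expr1 !mul1r !mulN1r /comm; noncomm R A.
Qed.

Lemma comm_santibracket t a b : homog false t ->
  comm t (sa a b) = sa (comm t a) b + sa a (comm t b).
Proof.
move=> ht; rewrite /santibracket !big_bool /= !spart_comm //.
rewrite ?expr0 ?expr1 !mul1r !mulN1r /comm; noncomm R A.
Qed.

Lemma sbracket_is_linear a : linear (sb a).
Proof.
move=> c u v; rewrite /sbracket !big_bool /= !linearP /=.
rewrite ?expr0 ?expr1 !mul1r !mulN1r; noncomm R A.
Qed.

HB.instance Definition _ t :=
  GRing.isLinear.Build R A A *:%R (sb t) (sbracket_is_linear t).

Lemma sbracketDr a u v : sb a (u + v) = sb a u + sb a v.
Proof. exact: linearD. Qed.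

Lemma sbracketZr (c : R) a u : sb a (c *: u) = c *: sb a u.
Proof. exact: linearZ. Qed.

Lemma sbracket0r a : sb a 0 = 0.
Proof. exact: linear0. Qed.

Lemma sbracketDl a b u : sb (a + b) u = sb a u + sb b u.
Proof.
rewrite /sbracket !big_bool /= !linearD /=.
rewrite ?expr0 ?expr1 !mul1r !mulN1r; noncomm R A.
Qed.

Lemma sbracketZl (c : R) a u : sb (c *: a) u = c *: sb a u.
Proof.
rewrite /sbracket !big_bool /= !linearZ /=.
rewrite ?expr0 ?expr1 !mul1r !mulN1r; noncomm R A.
Qed.

Lemma sbracket0l u : sb 0 u = 0.
Proof. by have := sbracketZl 0 0 u; rewrite !scale0r. Qed.

Lemma santibracket_is_linear a : linear (sa a).
Proof.
move=> c u v; rewrite /santibracket !big_bool /= !linearP /=.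
rewrite ?expr0 ?expr1 !mul1r !mulN1r; noncomm R A.
Qed.

HB.instance Definition _ t :=
  GRing.isLinear.Build R A A *:%R (sa t) (santibracket_is_linear t).

Lemma santibracketDr a u v : sa a (u + v) = sa a u + sa a v.
Proof. exact: linearD. Qed.

Lemma santibracketDl a b u : sa (a + b) u = sa a u + sa b u.
Proof.
rewrite /santibracket !big_bool /= !linearD /=.
rewrite ?expr0 ?expr1 !mul1r !mulN1r; noncomm R A.
Qed.

Lemma santibracketZr (c : R) a u : sa a (c *: u) = c *: sa a u.
Proof. exact: linearZ. Qed.

Lemma santibracket0r a : sa a 0 = 0.
Proof. exact: linear0. Qed.

Lemma santibracketZl (c : R) a u : sa (c *: a) u = c *: sa a u.
Proof.
rewrite /santibracket !big_bool /= !linearZ /=.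
rewrite ?expr0 ?expr1 !mul1r !mulN1r; noncomm R A.
Qed.

Lemma santibracket0l u : sa 0 u = 0.
Proof. by have := santibracketZl 0 0 u; rewrite !scale0r. Qed.

Lemma sbracket_skew p q a b : homog p a -> homog q b ->
  sb b a = - ((-1) ^+ (p && q) : R) *: sb a b.
Proof.
move=> ha hb; rewrite (sbracketZE ha hb) (sbracketZE hb ha) andbC.
by case: (p && q); rewrite ?expr0 ?expr1; noncomm R A.
Qed.

End SuperbracketCalculus.

(** * Consequences of single relations *)

Section BracketLemmas.
Variables (R : comNzRingType) (A : algType R).
Implicit Types (h u v w x y z : A) (c e f al : R).

Local Notation comm := (fun x y : A => x * y - y * x).

(** Bracketing the relation between two currents [u], [v] of the same charge
    with an element [y] of opposite charge that pairs with [u] only gives the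
    relation between the Cartan current of [u] and [v]; [e] and [f] are the
    signs of exchanging [y] with [v] and with [u]. *)
Lemma bracket_current_relation c (p q : bool) u u' v v' y :
    let e := (-1) ^+ p : R in let f := (-1) ^+ q : R in
    v * y = e *: (y * v) -> v' * y = e *: (y * v') ->
    (u' * v - e *: (v * u')) - (u * v' - e *: (v' * u))
      = c *: (u * v + e *: (v * u)) ->
  let h := u * y - f *: (y * u) in let h' := u' * y - f *: (y * u') in
  comm h' v - comm h v' = c *: (h * v + v * h).
Proof.
move=> e f vy vy' uv h h'.
pose X := (u' * v - e *: (v * u')) - (u * v' - e *: (v' * u))
      - c *: (u * v + e *: (v * u)).
have X0 : X = 0 by rewrite /X uv subrr.
pose V := v * y - e *: (y * v); pose V' := v' * y - e *: (y * v').
have V0 : V = 0 by rewrite /V vy subrr.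
have V'0 : V' = 0 by rewrite /V' vy' subrr.
apply/subr0_eq.
have ->: comm h' v - comm h v' - c *: (h * v + v * h) =
   e *: (X * y) - f *: (y * X)
   - e *: (u' * V) + f *: (V * u') + e *: (u * V')
   - f *: (V' * u) + (c * e) *: (u * V) + (c * f) *: (V * u).
  rewrite /X /V /V' /h /h' /e /f; case: p {e f vy vy' uv h h' X X0 V V0 V' V'0};
  case: q; rewrite ?expr0 ?expr1; noncomm R A.
by rewrite X0 V0 V'0 !(mul0r, mulr0, scaler0, addr0, subr0).
Qed.

(** The even instance, where the raising currents belong to the same node, so
    that [y] pairs with both of them. *)
Lemma bracket_self_relation c u u' v v' y hu hu' hv hv' :
    comm u y = hu -> comm u' y = hu' -> comm v y = hv -> comm v' y = hv' ->
    comm u' v - comm u v' = c *: (u * v + v * u) ->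
  (comm hu' v - comm hu v' - c *: (hu * v + v * hu))
  + (comm hv' u - comm hv u' - c *: (hv * u + u * hv)) = 0.
Proof.
move=> <- <- <- <- uv.
pose X := comm u' v - comm u v' - c *: (u * v + v * u).
have X0 : X = 0 by rewrite /X uv subrr.
transitivity (comm X y); last by rewrite X0 mul0r mulr0 subr0.
rewrite /X; noncomm R A.
Qed.

(** The odd instance, where the currents of the node anticommute. *)
Lemma bracket_odd_relation u v y hu hv :
    u * y + y * u = hu -> v * y + y * v = hv -> u * v + v * u = 0 ->
  comm hu v + comm hv u = 0.
Proof.
move=> <- <- uv; set X := u * v + v * u in uv.
transitivity (- comm X y); last by rewrite uv mul0r mulr0 subr0 oppr0.
rewrite /X; noncomm R A.
Qed.

(** The defining relations between a Cartan current and two currents of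
    opposite charge, in generating form
    [(z - s - c) h(z) x = x (z - s + c) h(z)] with [s] the shift of [x], combine
    into a second-order recurrence for the action on a superbracket. As [x] and
    [y] have opposite charges, the terms of first order in [c] only contain the
    difference of [W1] and [W2], which is zero as soon as the superbracket
    depends on the total degree only. *)
Lemma current_recurrence c e h h' h'' x x' y y' :
    comm h' x - comm h x' = c *: (h * x + x * h) ->
    comm h'' x - comm h' x' = c *: (h' * x + x * h') ->
    comm h' y - comm h y' = - c *: (h * y + y * h) ->
    comm h'' y - comm h' y' = - c *: (h' * y + y * h') ->
  let W := x * y - e *: (y * x) in let W1 := x' * y - e *: (y * x') in
  let W2 := x * y' - e *: (y' * x) in let W3 := x' * y' - e *: (y' * x') in
  comm h'' W = comm h' (W1 + W2) - comm h (W3 - (c * c) *: W)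
               + c *: (h * (W1 - W2) + (W1 - W2) * h).
Proof.
move=> hx h'x hy h'y W W1 W2 W3.
pose X := comm h' x - comm h x' - c *: (h * x + x * h).
pose X' := comm h'' x - comm h' x' - c *: (h' * x + x * h').
pose Y := comm h' y - comm h y' + c *: (h * y + y * h).
pose Y' := comm h'' y - comm h' y' + c *: (h' * y + y * h').
have X0 : X = 0 by rewrite /X hx subrr.
have X'0 : X' = 0 by rewrite /X' h'x subrr.
have Y0 : Y = 0 by rewrite /Y hy scaleNr addNr.
have Y'0 : Y' = 0 by rewrite /Y' h'y scaleNr addNr.
apply/subr0_eq.
transitivity (X' * y + x * Y' - X * y' - x' * Y + c *: (X * y + x * Y)
  - e *: (Y' * x + y * X' - Y * x' - y' * X - c *: (Y * x + y * X))).
  rewrite /W /W1 /W2 /W3 /X /X' /Y /Y'; noncomm R A.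
by rewrite X0 X'0 Y0 Y'0 !(mul0r, mulr0, scaler0, addr0, subr0).
Qed.

(** The quadratic correction in the logarithm of the Cartan current trades the
    relation in degree 0 and 1 for an action without anticommutator. *)
Lemma first_log_coefficient al eta h0 h1 x0 x1 :
    comm h0 x0 = al *: x0 -> comm h0 x1 = al *: x1 ->
  comm (h1 - eta *: (h0 * h0)) x0 = al *: x1 <->
  comm h1 x0 - comm h0 x1 = (al * eta) *: (h0 * x0 + x0 * h0).
Proof.
move=> e0 e1; have key : comm (h1 - eta *: (h0 * h0)) x0 - al *: x1
    = comm h1 x0 - comm h0 x1 - (al * eta) *: (h0 * x0 + x0 * h0)
      - eta *: (h0 * (comm h0 x0 - al *: x0) + (comm h0 x0 - al *: x0) * h0)
      + (comm h0 x1 - al *: x1) by noncomm R A.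
have z0 : comm h0 x0 - al *: x0 = 0 by rewrite e0 subrr.
have z1 : comm h0 x1 - al *: x1 = 0 by rewrite e1 subrr.
move: key; rewrite z0 z1 mulr0 mul0r !addr0 scaler0 subr0 => key.
split=> e; apply: subr0_eq; first by rewrite -key e subrr.
by rewrite key e subrr.
Qed.

(** Up to the factor [3 / (2 eta)], the element [t] is the coefficient of
    [z ^- 3] in the logarithm of [1 + 2 eta \sum_r h r z ^- (r + 1)]; like the
    coefficient of [z ^- 2], it acts on the currents without mixing in the
    [h]'s. *)
Lemma second_log_coefficient al eta h0 h1 h2 x0 x1 x2 :
    comm h0 x0 = al *: x0 -> comm h0 x1 = al *: x1 ->
    comm h1 x0 = al *: x1 + (al * eta) *: (h0 * x0 + x0 * h0) ->
    comm h1 x1 = al *: x2 + (al * eta) *: (h0 * x1 + x1 * h0) ->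
    comm h2 x0 - comm h1 x1 = (al * eta) *: (h1 * x0 + x0 * h1) ->
  let t := 3%:R *: h2 - (6%:R * eta) *: (h0 * h1)
           + (4%:R * (eta * eta)) *: (h0 * h0 * h0) in
  comm t x0 = (3%:R * al) *: x2 + (al * al * al * (eta * eta)) *: x0.
Proof.
move=> e0 e0' e1 e1' e2 t.
pose D0 := comm h0 x0 - al *: x0; pose D0' := comm h0 x1 - al *: x1.
pose D1 := comm h1 x0 - al *: x1 - (al * eta) *: (h0 * x0 + x0 * h0).
pose D1' := comm h1 x1 - al *: x2 - (al * eta) *: (h0 * x1 + x1 * h0).
pose D2 := comm h2 x0 - comm h1 x1 - (al * eta) *: (h1 * x0 + x0 * h1).
have D00 : D0 = 0 by rewrite /D0 e0 subrr.
have D0'0 : D0' = 0 by rewrite /D0' e0' subrr.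
have D10 : D1 = 0 by rewrite /D1 e1 [al *: x1 + _]addrC addrK subrr.
have D1'0 : D1' = 0 by rewrite /D1' e1' [al *: x2 + _]addrC addrK subrr.
have D20 : D2 = 0 by rewrite /D2 e2 subrr.
apply/subr0_eq; transitivity (
    3%:R *: D2 + 3%:R *: D1' - (6%:R * eta) *: (h0 * D1)
    - (6%:R * eta) *: (D0 * h1) - (3%:R * (al * eta)) *: D0'
    + (3%:R * (al * eta)) *: D1
    + (eta * eta) *: ((- (3%:R * (al * al)) : R) *: D0
        + (6%:R * al) *: (h0 * D0)
        + 4%:R *: (h0 * h0 * D0 - (2%:R * al) *: (h0 * D0) + (al * al) *: D0
                   + h0 * D0 * h0 - al *: (D0 * h0) + D0 * h0 * h0))).
  rewrite /t /D0 /D0' /D1 /D1' /D2; noncomm R A.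
by rewrite D00 D0'0 D10 D1'0 D20 !(mul0r, mulr0, scaler0, addr0, subr0).
Qed.

End BracketLemmas.

(** * Current realisation of the minimalistic generators *)

(** What the construction of the higher generators uses of a simple root
    system. [ac_separate] is the place where the root system of [sl(m|n)] with
    [m <> n] matters: a combination of rows of the Cartan matrix may vanish at
    two given nodes without vanishing at a third one. *)
Record affine_cartan (I : finType) := AffineCartan {
  ac_form :> I -> I -> int;
  ac_odd : I -> bool;
  ac_prev : I -> I;
  ac_next : I -> I;
  ac_sym : forall i j, ac_form i j = ac_form j i;
  ac_odd_isotropic : forall i, ac_odd i -> ac_form i i = 0;
  ac_small : forall i j, i != j -> (`|ac_form i j| <= 1)%N;
  ac_prev_neq : forall i, ac_prev i != i;
  ac_next_neq : forall i, ac_next i != i;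
  ac_prev_next : forall i, ac_prev i != ac_next i;
  ac_nbr : forall i, exists2 k, k != i & ac_form k i != 0;
  ac_other_nbr : forall i j, i != j -> ac_form i j != 0 ->
    exists k, [/\ k != i, k != j & ac_form k i != 0];
  ac_separate : forall i j k, i != j -> i != k ->
    exists c : I -> int, [/\ \sum_l c l * ac_form l i != 0,
      \sum_l c l * ac_form l j = 0 & \sum_l c l * ac_form l k = 0]
}.

Section Currents.
Variables (R : comNzRingType) (I : finType) (C : affine_cartan I).
Variables (A : superAlgType R) (eta : R) (x : bool -> I -> nat -> A).
Hypothesis int_unit : forall k : int, k != 0 -> exists u : R, u * k%:~R = 1.

Local Notation odd := (ac_odd C).
Local Notation sb := (@sbracket R A).
Local Notation sa := (@santibracket R A).

Definition xsign (s : bool) : R := (-1) ^+ s.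
Definition xcoef (s : bool) i j : R := xsign s * (C i j)%:~R.
Definition pairing i r t : A := sb (x false i r) (x true i t).
Definition cartan_current i r : A := pairing i r 0%N.
Local Notation h := cartan_current.
(** The coefficient of [z ^- 2] in the logarithm of
    [1 + 2 eta \sum_r h i r z ^- (r + 1)], divided by [2 eta]. *)
Definition log_cartan i : A := h i 1%N - eta *: (h i 0%N * h i 0%N).

(** The minimalistic relations for a family that already has all degrees; the
    higher members are tied to the generators by [mc_shift] alone. *)
Record minimal_currents : Prop := MinimalCurrents {
  mc_homog : forall s i r, homog (odd i) (x s i r);
  mc_hh : forall i j r t, (r <= 1)%N -> (t <= 1)%N ->
    comm (h i r) (h j t) = 0;
  mc_x0x0 : forall i j, i != j -> sb (x false i 0%N) (x true j 0%N) = 0;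
  mc_x0x1 : forall i, pairing i 0%N 1%N = h i 1%N;
  mc_h0x : forall s i j, comm (h i 0%N) (x s j 0%N) = xcoef s i j *: x s j 0%N;
  mc_shift : forall s i j r,
    comm (log_cartan i) (x s j r) = xcoef s i j *: x s j r.+1;
  mc_xx : forall s i j,
    sb (x s i 1%N) (x s j 0%N) - sb (x s i 0%N) (x s j 1%N)
    = (xcoef s i j * eta) *: sa (x s i 0%N) (x s j 0%N);
  mc_serre : forall s i j, i != j ->
    iter (1 + `|C i j|) (sb (x s i 0%N)) (x s j 0%N) = 0;
  mc_odd_nil : forall s i, odd i -> sb (x s i 0%N) (x s i 0%N) = 0;
  mc_quartic : forall s i, odd i ->
    sb (sb (x s (ac_prev C i) 0%N) (x s i 0%N))
       (sb (x s i 0%N) (x s (ac_next C i) 0%N)) = 0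
}.

Hypothesis M : minimal_currents.
Let hx := mc_homog M.

Lemma int_scale_eq0 (k : int) (a : A) : k != 0 -> k%:~R *: a = 0 -> a = 0.
Proof.
move=> /int_unit[u uk] ka.
by rewrite -[a]scale1r -uk -scalerA ka scaler0.
Qed.

Lemma nat_scale_eq0 (k : nat) (a : A) : (0 < k)%N -> k%:R *: a = 0 -> a = 0.
Proof. by move=> k0; apply: (@int_scale_eq0 k); case: k k0. Qed.

Lemma xsignK s (a : A) : xsign s *: (xsign s *: a) = a.
Proof. by rewrite scalerA /xsign -expr2 sqrr_sign scale1r. Qed.

Lemma xsign_eq0 s (a : A) : xsign s *: a = 0 -> a = 0.
Proof. by move=> sa0; rewrite -(xsignK s a) sa0 scaler0. Qed.

Lemma xcoef_eq0 s i j (a : A) : C i j != 0 -> xcoef s i j *: a = 0 -> a = 0.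
Proof.
move=> aij; rewrite /xcoef -scalerA => /xsign_eq0.
exact: int_scale_eq0.
Qed.

Lemma xcoef_true i j : xcoef true i j = - xcoef false i j.
Proof. by rewrite /xcoef /xsign expr0 expr1; ring. Qed.

Lemma homog_pairing i r t : homog false (pairing i r t).
Proof. by rewrite -(addbb (odd i)); apply: homog_sbracket; apply: hx. Qed.

Lemma homog_current i r : homog false (h i r).
Proof. exact: homog_pairing. Qed.
Let hh := homog_current.

Lemma homog_log_cartan i : homog false (log_cartan i).
Proof.
apply: homogB (hh _ _) _; apply: homogZ; exact: (homogM (hh _ _) (hh _ _)).
Qed.

Lemma comm_current_log i j r : (r <= 1)%N -> comm (h i r) (log_cartan j) = 0.
Proof.
move=> r1; rewrite commBr commZr commMr !(mc_hh M) //.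
by rewrite mul0r mulr0 addr0 scaler0 subrr.
Qed.

(** Since [C] separates nodes, suitable combinations of the logarithmic Cartan
    elements shift the index of a single [x s i r] and fix the currents of two
    other nodes; they commute with the degree-0 and degree-1 Cartan elements. *)
Lemma raising_element i j k : i != j -> i != k -> exists t,
  [/\ homog false t, forall s r, comm t (x s i r) = xsign s *: x s i r.+1,
      forall s r, comm t (x s j r) = 0, forall s r, comm t (x s k r) = 0
    & forall l r, (r <= 1)%N -> comm t (h l r) = 0].
Proof.
move=> ij ik; have [c [ci cj ck]] := ac_separate C ij ik.
have [u uc] := int_unit ci.
pose t := u *: \sum_l (c l)%:~R *: log_cartan l.
have tx s l r : comm t (x s l r)
    = (u * (\sum_k c k * C k l)%:~R) *: (xsign s *: x s l r.+1).
  rewrite commZl comm_suml -scalerA; congr (_ *: _).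
  rewrite rmorph_sum scaler_suml; apply: eq_bigr => l' _.
  rewrite commZl (mc_shift M) /xcoef rmorphM !scalerA; congr (_ *: _).
  ring.
exists t; split.
- apply/homogZ/homog_sum => l _; exact/homogZ/homog_log_cartan.
- by move=> s r; rewrite tx uc scale1r.
- by move=> s r; rewrite tx cj mulr0 scale0r.
- by move=> s r; rewrite tx ck mulr0 scale0r.
- move=> l r r1; rewrite commC commZr comm_sumr big1 ?scaler0 ?oppr0 //.
  by move=> l' _; rewrite commZr comm_current_log // scaler0.
Qed.

Lemma raising_node i : exists t, [/\ homog false t,
    forall s r, comm t (x s i r) = xsign s *: x s i r.+1
  & forall l r, (r <= 1)%N -> comm t (h l r) = 0].
Proof.
have [k ki _] := ac_nbr C i; rewrite eq_sym in ki.
by have [t [? ? _ _ ?]] := raising_element ki ki; exists t.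
Qed.

Lemma comm_current0 s i j r :
  comm (h i 0%N) (x s j r) = xcoef s i j *: x s j r.
Proof.
elim: r => [|r IH]; first exact: mc_h0x.
have [t [_ tj ht]] := raising_node j.
have := comm_commute (x s j r) (_ : comm (h i 0%N) t = 0).
rewrite commC ht // oppr0 => /(_ erefl); rewrite IH tj !commZr tj.
rewrite scalerA mulrC -scalerA.
by move/(congr1 (fun a => xsign s *: a)); rewrite !xsignK.
Qed.

(** ** Relations between different nodes *)

Lemma x_opposite_nodes i j r t : i != j -> sb (x false i r) (x true j t) = 0.
Proof.
move=> ij; have ji : j != i by rewrite eq_sym.
have [ti [hi txi txj _ _]] := raising_element ij ij.
have [tj [hj uxj uxi _ _]] := raising_element ji ji.
elim: r => [|r IH].
  elim: t => [|t IH]; first exact: mc_x0x0.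
  have := comm_sbracket (x false i 0%N) (x true j t) hj.
  rewrite IH comm0r uxi sbracket0l add0r uxj sbracketZr.
  by move/esym/xsign_eq0.
have := comm_sbracket (x false i r) (x true j t) hi.
rewrite IH comm0r txj sbracket0r addr0 txi sbracketZl.
by move/esym/xsign_eq0.
Qed.

Definition xx_defect s i j r t : A :=
  sb (x s i r.+1) (x s j t) - sb (x s i r) (x s j t.+1)
  - (xcoef s i j * eta) *: sa (x s i r) (x s j t).

Lemma xx_relation_neq s i j r t : i != j -> xx_defect s i j r t = 0.
Proof.
move=> ij; have ji : j != i by rewrite eq_sym.
have [ti [hi txi txj _ _]] := raising_element ij ij.
have [tj [hj uxj uxi _ _]] := raising_element ji ji.
elim: r => [|r IH].
  elim: t => [|t IH]; first by rewrite /xx_defect mc_xx // subrr.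
  have : comm tj (xx_defect s i j 0 t) = xsign s *: xx_defect s i j 0 t.+1.
    rewrite /xx_defect !commBr commZr !comm_sbracket // comm_santibracket //.
    rewrite !uxi !uxj !sbracket0l santibracket0l !sbracketZr santibracketZr !add0r.
    noncomm R A.
  by rewrite IH comm0r => /esym/xsign_eq0.
have : comm ti (xx_defect s i j r t) = xsign s *: xx_defect s i j r.+1 t.
  rewrite /xx_defect !commBr commZr !comm_sbracket // comm_santibracket //.
  rewrite !txi !txj !sbracket0r santibracket0r !sbracketZl santibracketZl !addr0.
  noncomm R A.
by rewrite IH comm0r => /esym/xsign_eq0.
Qed.

(** The Drinfeld relation between [h i] and [x s j] in degrees [p] and [r]. *)
Definition current_relation s i j p r : Prop :=
  comm (h i p.+1) (x s j r) - comm (h i p) (x s j r.+1)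
  = (xcoef s i j * eta) *: (h i p * x s j r + x s j r * h i p).

Lemma current_relation0 s i j r : current_relation s i j 0 r.
Proof.
apply/(first_log_coefficient _ _ (comm_current0 _ _ _ _)).
  exact: comm_current0.
exact: (mc_shift M).
Qed.

Lemma current_relation_neq_plus i j p r :
  i != j -> current_relation false i j p r.
Proof.
move=> ij; have ji : j != i by rewrite eq_sym.
have := @bracket_current_relation R A (xcoef false i j * eta)
  (odd i && odd j) (odd i && odd i) (x false i p) (x false i p.+1)
  (x false j r) (x false j r.+1) (x true i 0%N).
rewrite /= -!(sbracketZE (hx _ _ _) (hx _ _ _)).
rewrite -!(santibracketZE (hx _ _ _) (hx _ _ _)); apply.
- have := x_opposite_nodes r 0%N ji.
  by rewrite (sbracketZE (hx _ _ _) (hx _ _ _)) andbC => /subr0_eq.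
- have := x_opposite_nodes r.+1 0%N ji.
  by rewrite (sbracketZE (hx _ _ _) (hx _ _ _)) andbC => /subr0_eq.
- by apply/subr0_eq; apply: xx_relation_neq.
Qed.

Lemma sbracket_flip_pairing i p r : sb (x true i p) (x false i r)
  = - ((-1) ^+ (odd i && odd i) : R) *: pairing i r p.
Proof. exact: sbracket_skew. Qed.

(** For the negative charge the argument needs [h i p] as a bracket with
    [x false i 0] instead of [x true i 0], and these two descriptions agree only
    in degrees where the pairing is known to depend on the total degree. *)
Lemma current_relation_neq_minus i j p r :
    pairing i 0%N p = h i p -> pairing i 0%N p.+1 = h i p.+1 ->
  i != j -> current_relation true i j p r.
Proof.
move=> e0 e1 ij; have ji : j != i by rewrite eq_sym.
have := @bracket_current_relation R A (xcoef true i j * eta)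
  (odd i && odd j) (odd i && odd i) (x true i p) (x true i p.+1)
  (x true j r) (x true j r.+1) (x false i 0%N).
rewrite /= -!(sbracketZE (hx _ _ _) (hx _ _ _)).
rewrite -!(santibracketZE (hx _ _ _) (hx _ _ _)) !sbracket_flip_pairing e0 e1.
have opp q : x true j q * x false i 0%N
    = (-1) ^+ (odd i && odd j) *: (x false i 0%N * x true j q).
  have := x_opposite_nodes 0%N q ij.
  rewrite (sbracketZE (hx _ _ _) (hx _ _ _)) => /subr0_eq ->.
  by rewrite scalerA -expr2 sqrr_sign scale1r.
move=> /(_ (opp _) (opp _)) key.
have {}key := key (subr0_eq (xx_relation_neq _ _ _ ij)).
rewrite /current_relation /comm; move: key.
rewrite -/(xsign _) => key.
apply: subr0_eq; apply: (@xsign_eq0 (odd i && odd i)); apply: oppr_inj.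
by rewrite oppr0; move/eqP: key; rewrite -subr_eq0 => /eqP <-; noncomm R A.
Qed.

(** ** The Cartan currents *)

Definition pairing_upto r : Prop := forall i p q,
  (p + q <= r)%N -> pairing i p q = h i (p + q)%N.

Lemma pairing_upto1 : pairing_upto 1.
Proof.
move=> i [|[|p]] [|[|q]] // pq; exact: (mc_x0x1 M).
Qed.

Lemma comm_current0_pairing k i p q : comm (h k 0%N) (pairing i p q) = 0.
Proof.
rewrite /pairing comm_sbracket // !comm_current0 sbracketZl sbracketZr.
rewrite xcoef_true scaleNr; exact: subrr.
Qed.

Lemma comm_current1_pairing k i p q : comm (h k 1%N) (pairing i p q)
  = xcoef false k i *: (pairing i p.+1 q - pairing i p q.+1).
Proof.
have e : comm (log_cartan k) (pairing i p q) = comm (h k 1%N) (pairing i p q).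
  have := comm_current0_pairing k i p q => /comm0_eq e0.
  rewrite /log_cartan -scaleNr commDl commZl [comm (_ * _) _]comm_eq0.
    by rewrite scaler0 addr0.
  by rewrite -mulrA e0 !mulrA e0.
rewrite -e /pairing (comm_sbracket _ _ (homog_log_cartan k)) !(mc_shift M).
by rewrite sbracketZl sbracketZr xcoef_true scaleNr scalerBr.
Qed.

Lemma comm_current_pairing k i n p q :
    (forall s r, current_relation s k i n r) ->
    (forall s r, current_relation s k i n.+1 r) ->
  comm (h k n.+2) (pairing i p q) =
    comm (h k n.+1) (pairing i p.+1 q + pairing i p q.+1)
    - (comm (h k n) (pairing i p.+1 q.+1)
       - (xcoef false k i * eta * (xcoef false k i * eta))
         *: comm (h k n) (pairing i p q))
    + (xcoef false k i * eta) *: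
        (h k n * (pairing i p.+1 q - pairing i p q.+1)
         + (pairing i p.+1 q - pairing i p q.+1) * h k n).
Proof.
move=> rn rn1.
have rm r m : current_relation true k i m r -> comm (h k m.+1) (x true i r)
    - comm (h k m) (x true i r.+1) = - (xcoef false k i * eta)
      *: (h k m * x true i r + x true i r * h k m).
  by rewrite /current_relation xcoef_true mulNr.
have := current_recurrence ((-1) ^+ (odd i && odd i)) (rn false p)
  (rn1 false p) (rm q n (rn true q)) (rm q n.+1 (rn1 true q)).
rewrite /= -!(sbracketZE (hx _ _ _) (hx _ _ _)) -/(comm _ _) => ->.
by rewrite -/(comm _ _) -/(comm _ _) commBr commZr.
Qed.

(** The failure of [pairing i p q] to depend on [p + q] only, in the first
    degree in which it can fail. *)
Definition pairing_defect r i : A := pairing i r.+1 0 - pairing i r 1.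

(** By the recurrence, the degree-[n] Cartan current of [k] sees this failure
    at [i] with multiplicity [n]. *)
Lemma comm_current_upto r k i : pairing_upto r -> k != i ->
  forall n, (n <= r)%N -> forall q,
    ((n + q <= r)%N -> comm (h k n) (h i q) = 0) /\
    ((n + q)%N = r.+1 -> comm (h k n) (h i q)
       = (n%:R * xcoef false k i) *: pairing_defect r i).
Proof.
move=> Pr ki.
have base0 q : comm (h k 0%N) (h i q) = 0 by exact: comm_current0_pairing.
have rel s n t : (n < r)%N -> current_relation s k i n t.
  case: s => nr; last exact: current_relation_neq_plus.
  apply: current_relation_neq_minus => //; first by apply: Pr; lia.
  by apply: Pr; lia.
suff H n : ((n <= r)%N -> forall q,
    ((n + q <= r)%N -> comm (h k n) (h i q) = 0) /\
    ((n + q)%N = r.+1 -> comm (h k n) (h i q)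
       = (n%:R * xcoef false k i) *: pairing_defect r i)) /\
  ((n.+1 <= r)%N -> forall q,
    ((n.+1 + q <= r)%N -> comm (h k n.+1) (h i q) = 0) /\
    ((n.+1 + q)%N = r.+1 -> comm (h k n.+1) (h i q)
       = (n.+1%:R * xcoef false k i) *: pairing_defect r i)).
  by move=> n; have [] := H n.
elim: n => [|n [IH0 IH1]]; split=> //.
- by move=> _ q; rewrite base0 mul0r scale0r; split.
- move=> r1 q; rewrite [h i q]/(pairing i q 0%N) comm_current1_pairing.
  split=> qr; last by rewrite mul1r (_ : q = r) //; lia.
  rewrite !Pr ?addn0 ?addn1 ?subrr ?scaler0 //; lia.
move=> nr q; have nr0 : (n <= r)%N by lia.
have nr1 : (n < r)%N by lia.
have [IHa IHb] := IH0 nr0 q.+2; have [IHc IHd] := IH1 nr1 q.+1.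
have [IHe _] := IH0 nr0 q.
have main : (n.+2 + q <= r.+1)%N ->
    comm (h k n.+2) (h i q) = 2%:R *: comm (h k n.+1) (h i q.+1)
      - comm (h k n) (pairing i q.+1 1%N).
  move=> nq; rewrite [h i q]/(pairing i q 0%N) comm_current_pairing; first last.
  - by move=> s t; apply: rel.
  - by move=> s t; apply: rel; lia.
  have -> : pairing i q.+1 0 = h i q.+1 by [].
  have -> : pairing i q 1 = h i q.+1 by rewrite Pr ?addn1 //; lia.
  rewrite IHe; last by lia.
  rewrite subrr mulr0 mul0r addr0 !scaler0 subr0 addr0 commDr.
  by rewrite scaler_nat mulr2n.
have W3 : (n.+2 + q <= r.+1)%N ->
    comm (h k n) (pairing i q.+1 1%N) = comm (h k n) (h i q.+2).
  case: n {IH0 IH1 nr IHa IHb IHc IHd IHe main} nr0 nr1 => [|n] nr0 nr1 nq.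
    by rewrite base0 comm_current0_pairing.
  by congr (comm _ _); rewrite Pr ?addn1 //; lia.
split=> nq; rewrite main ?W3 //; try lia.
  by rewrite IHa ?IHc; [rewrite scaler0 subrr | lia | lia].
rewrite IHb ?IHd; try lia.
rewrite scalerA -scalerBl; congr (_ *: _).
rewrite -!natr1; ring.
Qed.

(** Comparing the two ways to compute the bracket of the degree-[r] current of
    one node and the degree-1 current of a neighbour shows that the defects
    [E] and [E'] at these nodes satisfy [r E = - E'] and [r E' = - E]. *)
Lemma pairing_defect_nbr r i k : pairing_upto r -> (0 < r)%N -> k != i ->
  C k i != 0 -> r%:R *: pairing_defect r i = - pairing_defect r k.
Proof.
move=> Pr r0 ki cki; have ik : i != k by rewrite eq_sym.
have [_ /(_ (addn1 r)) e1] := comm_current_upto Pr ki (leqnn r) 1%N.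
have [_ /(_ (add1n r)) e2] := comm_current_upto Pr ik r0 r.
apply/eqP; rewrite -subr_eq0 opprK; apply/eqP.
apply: (xcoef_eq0 (s := false) cki).
rewrite scalerDr scalerA [_ * r%:R]mulrC -e1 commC e2 mul1r.
by rewrite /xcoef (ac_sym C i k) addNr.
Qed.

Lemma pairing_defect_eq0 r i : pairing_upto r -> (0 < r)%N ->
  pairing_defect r i = 0.
Proof.
(* For [r = 1] the comparison with a neighbour is void, since [r * r - 1 = 0],
   but there [h i 1] is a generator that commutes with the raising element. *)
move=> Pr r0; have [r1|r1] := leqP r 1.
  have -> : r = 1%N by lia.
  have [t [ht tx th]] := raising_node i.
  have := comm_sbracket (x false i 1%N) (x true i 0%N) ht.
  rewrite !tx -/(pairing i 1 0) -/(h i 1%N) th // sbracketZl sbracketZr.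
  rewrite /xsign expr0 expr1 scale1r scaleN1r => e; exact: esym e.
have [k ki cki] := ac_nbr C i; have ik : i != k by rewrite eq_sym.
have cik : C i k != 0 by rewrite ac_sym.
have e1 := pairing_defect_nbr Pr r0 ki cki.
have e2 := pairing_defect_nbr Pr r0 ik cik.
apply: (@nat_scale_eq0 (r * r - 1)); first by lia.
rewrite natrB; last by lia.
by rewrite scalerBl natrM -scalerA e1 scalerN e2 opprK scale1r subrr.
Qed.

(** The defect at [i] computes the effect of raising on all pairings of total
    degree [r], because those are the same element [h i r]. *)
Lemma pairing_upto_succ r : pairing_upto r -> (0 < r)%N -> pairing_upto r.+1.
Proof.
move=> Pr r0 i.
have [t [ht tx _]] := raising_node i.
have step p q : comm t (pairing i p q) = pairing i p.+1 q - pairing i p q.+1.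
  rewrite /pairing comm_sbracket // !tx sbracketZl sbracketZr.
  by rewrite /xsign expr0 expr1 scale1r scaleN1r.
have tr0 : comm t (h i r) = 0.
  by rewrite [h i r]/(pairing i r 0) step; apply: pairing_defect_eq0.
have shift p q : (p + q)%N = r -> pairing i p.+1 q = pairing i p q.+1.
  by move=> pq; apply: subr0_eq; rewrite -step Pr pq // tr0.
move=> p q; elim: q p => [|q IH] p pq; first by rewrite addn0.
have [pqr|pqr] := leqP (p + q.+1) r; first exact: Pr.
rewrite -shift; last by lia.
by rewrite IH ?addSnnS //; lia.
Qed.

Lemma pairingE i p q : pairing i p q = h i (p + q)%N.
Proof.
suff P r : pairing_upto r.+1 by apply: (P (p + q)%N).
by elim: r => [|r IH]; [exact: pairing_upto1 | apply: pairing_upto_succ].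
Qed.


(** ** Relations between currents of one node *)

Lemma current_relation_neq s i j p r : i != j -> current_relation s i j p r.
Proof.
case: s => ij; last exact: current_relation_neq_plus.
by apply: current_relation_neq_minus; rewrite ?pairingE.
Qed.

Lemma comm_current1 s i j r : comm (h i 1%N) (x s j r) =
  xcoef s i j *: x s j r.+1
  + (xcoef s i j * eta) *: (h i 0%N * x s j r + x s j r * h i 0%N).
Proof.
have /eqP := current_relation0 s i j r.
by rewrite /current_relation comm_current0 subr_eq addrC => /eqP ->.
Qed.

(** A shift by two, up to a term of lower degree. The case [j = k] is excluded
    because the relation between [h k 2] and the currents of [k] itself is
    derived from these shifts. *)
Lemma second_shift k : exists2 t, homog false t &
  forall s j r, k != j -> comm t (x s j r) =
    (3%:R * xcoef s k j) *: x s j r.+2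
    + (xcoef s k j * xcoef s k j * xcoef s k j * (eta * eta)) *: x s j r.
Proof.
exists (3%:R *: h k 2 - (6%:R * eta) *: (h k 0%N * h k 1%N)
   + (4%:R * (eta * eta)) *: (h k 0%N * h k 0%N * h k 0%N)).
  apply: homogD; first apply: homogB; apply: homogZ; rewrite ?hh //.
    exact: (homogM (hh _ _) (hh _ _)).
  exact: (homogM (homogM (hh _ _) (hh _ _)) (hh _ _)).
move=> s j r kj; apply: (@second_log_coefficient R A (xcoef s k j) eta
  (h k 0%N) (h k 1%N) (h k 2%N) (x s j r) (x s j r.+1) (x s j r.+2)).
- exact: comm_current0.
- exact: comm_current0.
- exact: comm_current1.
- exact: comm_current1.
- exact: (current_relation_neq s 1 r kj).
Qed.

(** A family that is symmetric in two indices vanishes if it vanishes at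
    [(0, 0)] and its vanishing is stable under [X + Y] and [X ^ 2 + Y ^ 2],
    where [X] and [Y] raise the two indices. Indeed it is then stable under
    [2 X Y = (X + Y) ^ 2 - (X ^ 2 + Y ^ 2)], which reduces the claim to the
    entries [(0, q)]; there [Y ^ q = Y ^ (q - 1) (X + Y) - X Y ^ (q - 1)] lowers
    [q], and [q = 1] follows from the symmetry. The index [z] is a spectator
    that the operators may move. *)
Lemma symmetric_family_eq0 (T : Type) (F : nat -> nat -> T -> A) s t1 :
    (forall p q z, F p q z = F q p z) -> (forall z, F 0 0 z = 0) ->
    (forall p q z, comm t1 (F p q z) = xsign s *: (F p.+1 q z + F p q.+1 z)) ->
    (forall p q, (forall z, F p q z = 0) ->
       forall z, F p.+2 q z + F p q.+2 z = 0) ->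
  forall p q z, F p q z = 0.
Proof.
move=> sym F0 F1 F2.
have step1 p q : (forall z, F p q z = 0) ->
    forall z, F p.+1 q z + F p q.+1 z = 0.
  move=> pq z; have := F1 p q z; rewrite pq comm0r => /esym.
  exact: xsign_eq0.
have step11 p q : (forall z, F p q z = 0) -> forall z, F p.+1 q.+1 z = 0.
  move=> pq z; have := congr1 (comm t1) (step1 _ _ pq z).
  rewrite comm0r commDr !F1 -scalerDr => /xsign_eq0 e.
  apply: (@nat_scale_eq0 2) => //; rewrite -[RHS]e.
  apply: subr0_eq; apply: oppr_inj; rewrite oppr0 -[RHS](F2 _ _ pq z).
  noncomm R A.
have F0q q z : F 0 q z = 0.
  have [n] := ubnP q; elim: n q z => // n IH [|[|q]] z qn //.
    apply: (@nat_scale_eq0 2) => //; rewrite scaler_nat mulr2n.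
    by rewrite {1}sym; apply: step1 => z'.
  have q1 z' : F 0 q.+1 z' = 0 by apply: IH.
  have := step1 _ _ q1 z; rewrite step11 ?add0r // => z'.
  by apply: IH; lia.
elim=> [|p IH] [|q] z; rewrite ?F0q //; first by rewrite sym F0q.
exact: step11.
Qed.

Lemma comm_second_xx_defect t (a b : R) s i r q :
    homog false t ->
    (forall r', comm t (x s i r') = a *: x s i r'.+2 + b *: x s i r') ->
  comm t (xx_defect s i i r q) =
    a *: (xx_defect s i i r.+2 q + xx_defect s i i r q.+2)
    + (2%:R * b) *: xx_defect s i i r q.
Proof.
move=> ht tx; rewrite /xx_defect !commBr commZr.
rewrite !comm_sbracket // comm_santibracket // !tx.
rewrite !(sbracketDl, sbracketDr, sbracketZl, sbracketZr).
rewrite !(santibracketDl, santibracketDr, santibracketZl, santibracketZr).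
noncomm R A.
Qed.

Lemma comm_raise_xx_defect t s i r q : homog false t ->
    (forall r', comm t (x s i r') = xsign s *: x s i r'.+1) ->
  comm t (xx_defect s i i r q)
  = xsign s *: (xx_defect s i i r.+1 q + xx_defect s i i r q.+1).
Proof.
move=> ht tx; rewrite /xx_defect !commBr commZr.
rewrite !comm_sbracket // comm_santibracket // !tx.
rewrite !(sbracketDl, sbracketDr, sbracketZl, sbracketZr).
rewrite !(santibracketDl, santibracketDr, santibracketZl, santibracketZr).
noncomm R A.
Qed.

(** The element realising [X ^ 2 + Y ^ 2] comes from a neighbour of [i], for
    which the relation with the currents of [i] is already known. *)
Lemma quadratic_raising i : exists2 t, homog false t &
  forall s, exists k a b, [/\ C k i != 0, a = 3%:R * xcoef s k i &
    forall r, comm t (x s i r) = a *: x s i r.+2 + b *: x s i r].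
Proof.
have [k ki cki] := ac_nbr C i; have [t ht tx] := second_shift k.
exists t => // s; exists k, (3%:R * xcoef s k i).
by eexists; split=> // r; apply: tx.
Qed.

Lemma coef3_eq0 s k i (a : A) :
  C k i != 0 -> (3%:R * xcoef s k i) *: a = 0 -> a = 0.
Proof.
by move=> cki; rewrite -scalerA => /nat_scale_eq0 H; apply/(xcoef_eq0 cki)/H.
Qed.

Lemma odd_nilpotent s i r q : odd i -> sb (x s i r) (x s i q) = 0.
Proof.
move=> oi; have [t1 [h1 t1x _]] := raising_node i.
have [t2 h2 /(_ s)[k [a [b [cki a_def t2x]]]]] := quadratic_raising i.
apply: (@symmetric_family_eq0 unit (fun r q _ => sb (x s i r) (x s i q)) s t1
  _ _ _ _ r q tt).
- move=> p p' _; rewrite (sbracket_skew (hx _ _ _) (hx _ _ _)) oi /=.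
  by rewrite expr1 opprK scale1r.
- by move=> _; apply: mc_odd_nil.
- by move=> p p' _; rewrite comm_sbracket // !t1x sbracketZl sbracketZr scalerDr.
move=> p p' /(_ tt) e _; apply: (coef3_eq0 (s := s) cki); rewrite -a_def.
have := comm_sbracket (x s i p) (x s i p') h2.
rewrite e comm0r !t2x !(sbracketDl, sbracketDr, sbracketZl, sbracketZr) e.
by rewrite !scaler0 !addr0 -scalerDr => /esym.
Qed.

Lemma odd_xcoef s i : odd i -> xcoef s i i = 0.
Proof. by move=> oi; rewrite /xcoef ac_odd_isotropic // mulr0. Qed.

Lemma xx_relation s i j r q : xx_defect s i j r q = 0.
Proof.
have [<-{j}|/xx_relation_neq->//] := eqVneq i j.
case oi: (odd i).
  by rewrite /xx_defect !odd_nilpotent // odd_xcoef // mul0r scale0r !subr0.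
have [t1 [h1 t1x _]] := raising_node i.
have [t2 h2 /(_ s)[k [a [b [cki a_def t2x]]]]] := quadratic_raising i.
have he p : homog false (x s i p) by have := hx s i p; rewrite oi.
apply: (@symmetric_family_eq0 unit (fun r q _ => xx_defect s i i r q) s t1
  _ _ _ _ r q tt).
- move=> p p' _; rewrite /xx_defect !(sbracket_even (he _) (he _)).
  rewrite !(santibracket_even (he _) (he _)) /comm; noncomm R A.
- by move=> _; rewrite /xx_defect mc_xx // subrr.
- by move=> p p' _; apply: comm_raise_xx_defect.
move=> p p' /(_ tt) e _; apply: (coef3_eq0 (s := s) cki); rewrite -a_def.
have := comm_second_xx_defect p p' h2 t2x.
by rewrite e comm0r scaler0 addr0 => /esym.
Qed.

(** Bracketing the relations among the [x s i r] with a current of opposite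
    charge at [i] gives a sum of two instances of the claim, with [p], [r]
    equal to [(a + t, b)] and [(b + t, a)]; the choice [a = b = 0] proves the
    instances with [r = 0], and then [a = 0] proves all of them. *)
Lemma current_relation_self s i p r : current_relation s i i p r.
Proof.
have pf p' q : sb (x s i p') (x (~~ s) i q)
    = (if s then - ((-1) ^+ (odd i)) else 1) *: h i (p' + q)%N.
  case: s => /=; last by rewrite scale1r -pairingE.
  by rewrite sbracket_flip_pairing pairingE andbb addnC.
case oi: (odd i).
  have sgn1 : (if s then - ((-1) ^+ (odd i)) else 1) = 1 :> R.
    by rewrite oi expr1 opprK; case: (s).
  suff G p' q : comm (h i p') (x s i q) = 0.
    by rewrite /current_relation !G odd_xcoef // mul0r scale0r subr0.
  have Gsym a b t :
      comm (h i (a + t)) (x s i b) + comm (h i (b + t)) (x s i a) = 0.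
    have pf' c : x s i c * x (~~ s) i t + x (~~ s) i t * x s i c
        = h i (c + t)%N.
      have := pf c t; rewrite (sbracketZE (hx _ _ _) (hx _ _ _)) sgn1 oi /=.
      by rewrite scale1r expr1 scaleN1r opprK.
    apply: (bracket_odd_relation (pf' a) (pf' b)).
    have := odd_nilpotent s a b oi.
    rewrite (sbracketZE (hx _ _ _) (hx _ _ _)) oi /=.
    by rewrite expr1 scaleN1r opprK.
  have G0 t : comm (h i t) (x s i 0) = 0.
    apply: (@nat_scale_eq0 2) => //; rewrite scaler_nat mulr2n.
    exact: (Gsym 0%N 0%N t).
  by have := Gsym 0%N q p'; rewrite G0 addr0 add0n.
have he s' p' : homog false (x s' i p') by have := hx s' i p'; rewrite oi.
pose H p' q := comm (h i p'.+1) (x s i q) - comm (h i p') (x s i q.+1)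
  - (xcoef s i i * eta) *: (h i p' * x s i q + x s i q * h i p').
have Hsym a b t : H (a + t)%N b + H (b + t)%N a = 0.
  have pf' c : comm (x s i c) (x (~~ s) i t) = xsign s *: h i (c + t)%N.
    rewrite -(sbracket_even (he _ _) (he _ _)) pf oi expr0 /xsign.
    by case: (s); rewrite ?expr1.
  have := bracket_self_relation (pf' a) (pf' a.+1) (pf' b) (pf' b.+1).
  have := subr0_eq (xx_relation s i i a b).
  rewrite !(sbracket_even (he _ _) (he _ _)).
  rewrite (santibracket_even (he _ _) (he _ _)) => e /(_ _ e) {}e.
  apply: (@xsign_eq0 s); rewrite -[RHS]e /H /comm !addSn; noncomm R A.
have H0 t : H t 0 = 0.
  apply: (@nat_scale_eq0 2) => //; rewrite scaler_nat mulr2n.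
  exact: (Hsym 0%N 0%N t).
apply: subr0_eq; rewrite -/(H p r).
by have := Hsym 0%N r p; rewrite H0 addr0 add0n.
Qed.

Lemma current_relation_all s i j p r : current_relation s i j p r.
Proof.
have [<-|ij] := eqVneq i j; first exact: current_relation_self.
exact: current_relation_neq.
Qed.

Lemma currents_commute k i p q : comm (h k p) (h i q) = 0.
Proof.
suff H n : (forall q', comm (h k n) (h i q') = 0) /\
           (forall q', comm (h k n.+1) (h i q') = 0) by have [] := H p.
elim: n => [|n [IH0 IH1]]; split=> // q'; first exact: comm_current0_pairing.
  rewrite [h i q']/(pairing i q' 0%N) comm_current1_pairing.
  by rewrite !pairingE addn0 addn1 subrr scaler0.
rewrite [h i q']/(pairing i q' 0%N) comm_current_pairing; first last.
- by move=> s r; apply: current_relation_all.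
- by move=> s r; apply: current_relation_all.
rewrite !pairingE commDr !IH0 !IH1 addn0 addn1 subrr mulr0 mul0r.
by rewrite !(addr0, scaler0, subr0).
Qed.

Lemma sbracket_current s i j p r :
  sb (h i p) (x s j r) = comm (h i p) (x s j r).
Proof. exact: (sbracket_even (hh _ _) (hx _ _ _)). Qed.

Lemma sbracket_current_relation s i j p r :
  sb (h i p.+1) (x s j r) - sb (h i p) (x s j r.+1)
  = (xcoef s i j * eta) *: sa (h i p) (x s j r).
Proof.
rewrite !sbracket_current (santibracket_even (hh _ _) (hx _ _ _)).
exact: current_relation_all.
Qed.

Lemma sbracket_currents k i p q : sb (h k p) (h i q) = 0.
Proof. by rewrite (sbracket_even (hh _ _) (hh _ _)) currents_commute. Qed.

Lemma xx_bracket_relation s i j r q :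
  sb (x s i r.+1) (x s j q) - sb (x s i r) (x s j q.+1)
  = (xcoef s i j * eta) *: sa (x s i r) (x s j q).
Proof. exact/subr0_eq/xx_relation. Qed.

(** ** Serre relations *)

Lemma far_nodes_commute s i j r q :
  i != j -> C i j = 0 -> sb (x s i r) (x s j q) = 0.
Proof.
move=> ij cij; have ji : j != i by rewrite eq_sym.
have [ti [hi txi txj _ _]] := raising_element ij ij.
have [tj [hj uxj uxi _ _]] := raising_element ji ji.
elim: r => [|r IH].
  elim: q => [|q IH]; first by have := mc_serre M s ij; rewrite cij.
  have := comm_sbracket (x s i 0%N) (x s j q) hj.
  rewrite IH comm0r uxi sbracket0l add0r uxj sbracketZr.
  by move/esym/xsign_eq0.
have := comm_sbracket (x s i r) (x s j q) hi.
rewrite IH comm0r txj sbracket0r addr0 txi sbracketZl.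
by move/esym/xsign_eq0.
Qed.

(** The symmetric argument applies to the two indices at [i], with that of [j]
    as spectator. The shift by two is taken from the neighbour of [i] other
    than [j], so that its action on the currents of [j] is known as well. *)
Lemma cubic_serre s i j p q r : i != j -> `|C i j|%N = 1%N ->
  sb (x s i p) (sb (x s i q) (x s j r))
  + sb (x s i q) (sb (x s i p) (x s j r)) = 0.
Proof.
move=> ij cij; have ji : j != i by rewrite eq_sym.
have cij0 : C i j != 0 by apply/eqP => e; rewrite e in cij.
have [ti [hi txi txj _ _]] := raising_element ij ij.
have [tj [hj uxj uxi _ _]] := raising_element ji ji.
have [k [ki kj cki]] := ac_other_nbr ij cij0.
have [t ht tx] := second_shift k.
apply: (@symmetric_family_eq0 nat (fun p q r =>
    sb (x s i p) (sb (x s i q) (x s j r))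
    + sb (x s i q) (sb (x s i p) (x s j r))) s ti _ _ _ _ p q r).
- by move=> a b z; rewrite addrC.
- elim=> [|z IH].
    by have := mc_serre M s ij; rewrite cij => /= ->; rewrite addr0.
  have /(congr1 (comm tj)) := IH.
  rewrite comm0r commDr !comm_sbracket // !uxi !uxj !sbracket0l !add0r.
  by rewrite !sbracketZr -scalerDr => /xsign_eq0.
- move=> a b z; rewrite commDr !comm_sbracket // !txi !txj.
  rewrite !(sbracket0r, addr0, sbracketDr, sbracketZl, sbracketZr).
  noncomm R A.
move=> a b F0 z; apply: (coef3_eq0 (s := s) cki).
have /(congr1 (comm t)) := F0 z.
rewrite comm0r commDr !comm_sbracket // !tx //.
rewrite !(sbracketDl, sbracketDr, sbracketZl, sbracketZr) => e.
pose cb l := xcoef s k l * xcoef s k l * xcoef s k l * (eta * eta).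
have := F0 z; have := F0 z.+2; set f2 := _ + _ => f20; set f0 := _ + _ => f00.
have main : 0 = 0 - (3%:R * xcoef s k j) *: f2
    - (2%:R * cb i + cb j) *: f0 by rewrite f20 f00 !scaler0 !subr0.
(* The image under [t] is the claim plus multiples of [f2] and [f0]. *)
rewrite [RHS]main -[in RHS]e /f0 /f2 /cb; noncomm R A.
Qed.

Lemma quartic_serre s i r q : odd i ->
  sb (sb (x s (ac_prev C i) r) (x s i 0%N))
     (sb (x s i 0%N) (x s (ac_next C i) q)) = 0.
Proof.
move=> oi; set i1 := ac_prev C i; set i2 := ac_next C i.
have i1i : i1 != i := ac_prev_neq C i.
have i2i : i2 != i := ac_next_neq C i.
have i12 : i1 != i2 := ac_prev_next C i.
have i21 : i2 != i1 by rewrite eq_sym.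
have [t [ht t1 t0 t2 _]] := raising_element i1i i12.
have [u [hu u2 u0 u1 _]] := raising_element i2i i21.
elim: r => [|r IH].
  elim: q => [|q IH]; first exact: mc_quartic.
  have /(congr1 (comm u)) := IH.
  rewrite comm0r !comm_sbracket // u0 u1 u2.
  rewrite !(sbracket0l, sbracket0r, add0r, addr0) !sbracketZr.
  exact: xsign_eq0.
have /(congr1 (comm t)) := IH.
rewrite comm0r !comm_sbracket // t0 t1 t2.
rewrite !(sbracket0l, sbracket0r, add0r, addr0) !sbracketZl.
exact: xsign_eq0.
Qed.

Lemma sum_S2 (F : 'I_2 -> 'I_2 -> A) :
  \sum_(sigma : 'S_2) F (sigma ord0) (sigma ord_max)
  = F ord0 ord_max + F ord_max ord0.
Proof.
have ord2 (k : 'I_2) : (k == ord0) || (k == ord_max).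
  by case: k => [[|[|?]]] ?.
rewrite (bigD1 1%g) //= (bigD1 (tperm ord0 ord_max)) /=; last first.
  apply/eqP => /permP/(_ ord0); rewrite tpermL perm1.
  by move/(congr1 val).
rewrite !perm1 tpermL tpermR big1 ?addr0 // => sigma /andP[n1 nt].
exfalso; have inj : sigma ord0 != sigma ord_max.
  by rewrite (inj_eq perm_inj).
have P2 (tau : 'S_2) : sigma ord0 = tau ord0 -> sigma ord_max = tau ord_max ->
    sigma = tau.
  by move=> e0 e1; apply/permP => k; case/orP: (ord2 k) => /eqP ->.
have := ord2 (sigma ord0); have := ord2 (sigma ord_max).
case/orP => /eqP e1; case/orP => /eqP e0.
- by rewrite e0 e1 eqxx in inj.
- by move/eqP: nt; apply; apply: P2; rewrite ?tpermL ?tpermR.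
- by move/eqP: n1; apply; apply: P2; rewrite ?perm1.
- by rewrite e0 e1 eqxx in inj.
Qed.

Lemma symmetrized_serre s i j (r : 'I_(1 + `|C i j|) -> nat) q : i != j ->
  \sum_(sigma : 'S_(1 + `|C i j|))
     foldr (fun k y => sb (x s i (r (sigma k))) y) (x s j q)
           (enum 'I_(1 + `|C i j|)) = 0.
Proof.
move=> ij; have := ac_small C ij.
have cub a b := @cubic_serre s i j a b q ij.
have far a := @far_nodes_commute s i j a q ij.
move: r; case e: `|C i j|%N cub far => [|[|a]] // cub far r _.
- rewrite big1 // => sigma _; rewrite enum_ordSl /= (_ : enum 'I_0 = [::]) /=.
    by apply: far; apply/eqP; rewrite -absz_eq0 e.
  by apply: size0nil; rewrite size_enum_ord.
pose F a b := sb (x s i (r a)) (sb (x s i (r b)) (x s j q)).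
apply: etrans (etrans (sum_S2 F) (cub _ _ (erefl _))).
apply: eq_bigr => sigma _.
rewrite !enum_ordSl /= (_ : enum 'I_0 = [::]) /=.
  by congr (sb _ (sb (x s i (r (sigma _))) _)); apply: val_inj.
by apply: size0nil; rewrite size_enum_ord.
Qed.

End Currents.

(** * The Cartan matrix of a simple root system *)

Lemma val_ordS N (i : 'I_N) :
  ordS i = (if i.+1 == N then 0 else i.+1)%N :> nat.
Proof.
rewrite /=; case: eqP => [->|ne]; first exact: modnn.
by rewrite modn_small //; have := ltn_ord i; lia.
Qed.

Lemma ord_eqE N (i j : 'I_N) : (i == j) = (i == j :> nat).
Proof. by []. Qed.

Section RootSystem.
Variables (m n : nat) (Pi : simpleRootSystem m n).
Hypotheses (m_ge2 : (2 <= m)%N) (n_ge2 : (2 <= n)%N) (m_neq_n : m <> n).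
Local Notation N := (m + n)%N.
Implicit Types i j k l p : 'I_N.

Definition symb_sign (t : symb m n) : int := if is_eps t then 1 else -1.
Definition rs_sign i : int := symb_sign (rs_symb Pi i).

Lemma rs_signK i : rs_sign i * rs_sign i = 1.
Proof. by rewrite /rs_sign /symb_sign; case: is_eps. Qed.

Lemma rs_sign_neq0 i : rs_sign i != 0.
Proof. by rewrite /rs_sign /symb_sign; case: is_eps. Qed.

Lemma kappa_coord (z : int) : (kappa m n *~ z).1 = 0.
Proof. by rewrite (raddfMz fst) mul0rz. Qed.

Lemma rs_root_coord i t :
  (rs_root Pi i).1 t = (t == rs_symb Pi i)%:R - (t == rs_symb Pi (ordS i))%:R.
Proof.
rewrite /rs_root /= (_ : (if i == 0%N :> nat then kappa m n else 0).1 = 0);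
  last by case: ifP.
by rewrite !kappa_coord !addr0 !ffunE.
Qed.

Lemma sum_symb i (f : symb m n -> int) :
  \sum_t (t == rs_symb Pi i)%:R * f t = f (rs_symb Pi i).
Proof.
rewrite (bigD1 (rs_symb Pi i)) //= eqxx mul1r big1 ?addr0 // => t /negPf ->.
by rewrite mul0r.
Qed.

Lemma rs_symb_eq i j : (rs_symb Pi i == rs_symb Pi j) = (i == j).
Proof. by rewrite (inj_eq (bij_inj (rs_symb_bij Pi))). Qed.

Lemma rs_cartanE i j : rs_cartan Pi i j =
  (i == j)%:R * (rs_sign i + rs_sign (ordS i))
  - (i == ordS j)%:R * rs_sign i - (ordS i == j)%:R * rs_sign j.
Proof.
pose f t := symb_sign t * (rs_root Pi j).1 t.
have -> : rs_cartan Pi i j = f (rs_symb Pi i) - f (rs_symb Pi (ordS i)).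
  rewrite -!sum_symb -sumrB; apply: eq_bigr => t _.
  rewrite rs_root_coord /f -/(symb_sign t); ring.
rewrite /f !rs_root_coord !rs_symb_eq -!/(rs_sign _).
rewrite (inj_eq (can_inj (@ordSK N))).
by case: (eqVneq (ordS i) j) => [<-|_] /=; ring.
Qed.

Lemma N_ge5 : (5 <= N)%N. Proof. lia. Qed.

Lemma ordS_neq i : ordS i != i.
Proof. by have := N_ge5; rewrite ord_eqE val_ordS; case: (i.+1 =P N); lia. Qed.

Lemma ordSS_neq i : ordS (ordS i) != i.
Proof.
have := N_ge5; have := ltn_ord i; rewrite ord_eqE !val_ordS.
by case: (i.+1 =P N) => ?; case: (_ =P N); lia.
Qed.

Lemma ord_pred_neq_ordS i : ord_pred i != ordS i.
Proof.
by rewrite -(inj_eq (can_inj (@ordSK N))) ord_predK eq_sym ordSS_neq.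
Qed.

Lemma ord_pred_neq i : ord_pred i != i.
Proof. by rewrite -(inj_eq (can_inj (@ordSK N))) ord_predK eq_sym ordS_neq. Qed.

Lemma cartan_next i : rs_cartan Pi (ordS i) i != 0.
Proof.
rewrite rs_cartanE eqxx (negPf (ordS_neq i)) (negPf (ordSS_neq i)).
by rewrite !mul0r mul1r sub0r subr0 oppr_eq0 rs_sign_neq0.
Qed.

Lemma cartan_sym i j : rs_cartan Pi i j = rs_cartan Pi j i.
Proof.
by apply: eq_bigr => t _; rewrite [(rs_root Pi i).1 t * _]mulrC.
Qed.

Lemma cartan_prev i : rs_cartan Pi (ord_pred i) i != 0.
Proof. by rewrite cartan_sym -{1}(ord_predK i) cartan_next. Qed.

Lemma cartan_odd i : rs_odd Pi i -> rs_cartan Pi i i = 0.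
Proof.
rewrite rs_cartanE eqxx eq_sym (negPf (ordS_neq i)) !mul0r !subr0 mul1r.
by rewrite /rs_odd /rs_sign /symb_sign; do 2!case: is_eps.
Qed.

Lemma cartan_small i j : i != j -> (`|rs_cartan Pi i j| <= 1)%N.
Proof.
move=> /negPf ij; rewrite rs_cartanE ij mul0r sub0r.
rewrite /rs_sign /symb_sign; case: (i =P ordS j) => [->|_].
  by rewrite (negPf (ordSS_neq j)) mul0r subr0; case: is_eps.
by rewrite mul0r; case: eqP => _; case: is_eps.
Qed.

Lemma cartan_other i j : i != j -> rs_cartan Pi i j != 0 ->
  exists k, [/\ k != i, k != j & rs_cartan Pi k i != 0].
Proof.
move=> ij; rewrite rs_cartanE (negPf ij) mul0r sub0r.
have [ijS _|_] := eqVneq i (ordS j).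
  exists (ordS i); rewrite ordS_neq cartan_next {1}ijS; split=> //.
  exact: ordSS_neq.
have [<- _|_] := eqVneq (ordS i) j; last by rewrite !mul0r oppr0 subr0 eqxx.
by exists (ord_pred i); rewrite ord_pred_neq cartan_prev ord_pred_neq_ordS.
Qed.

Lemma sum_rs_sign : \sum_i rs_sign i = m%:Z - n%:Z.
Proof.
have -> : \sum_i rs_sign i = \sum_t symb_sign t.
  by rewrite (reindex (rs_symb Pi)) //; apply/onW_bij/rs_symb_bij.
rewrite big_sumType /= !sumr_const !card_ord.
by rewrite mulNrn !natz.
Qed.

Lemma cartan_comb (c : 'I_N -> int) j : \sum_l c l * rs_cartan Pi l j =
  rs_sign j * (c j - c (ord_pred j))
  - rs_sign (ordS j) * (c (ordS j) - c j).
Proof.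
have pick (f : 'I_N -> int) k : \sum_l f l * (l == k)%:R = f k.
  rewrite (bigD1 k) //= eqxx mulr1 big1 ?addr0 // => l /negPf ->.
  by rewrite mulr0.
have pickS (f : 'I_N -> int) k : \sum_l f l * (ordS l == k)%:R = f (ord_pred k).
  rewrite -[RHS](pick f); apply: eq_bigr => l _; congr (_ * (nat_of_bool _)%:R).
  by rewrite -{1}(ord_predK k) (inj_eq (can_inj (@ordSK N))).
transitivity (\sum_l (c l * (rs_sign l + rs_sign (ordS l))) * (l == j)%:R
  - \sum_l (c l * rs_sign l) * (l == ordS j)%:R
  - \sum_l (c l * rs_sign j) * (ordS l == j)%:R).
  rewrite -!sumrB; apply: eq_bigr => l _; rewrite rs_cartanE; ring.
rewrite !pick pickS; ring.
Qed.

(** The vector with coordinates [rs_sign l * nu l] pairs with the [j]-th simple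
    root to [nu j - nu (ordS j)], and it lies in the root lattice if its
    coordinates sum up to zero. For [nu] an affine function of the indicator of
    the arc between [i] and a further node [p], this can be achieved because
    the signs sum up to [m - n], which is not zero, and the pairing vanishes
    except at [i] and [p]. *)
Lemma cartan_separate i j k : i != j -> i != k -> exists c : 'I_N -> int,
  [/\ \sum_l c l * rs_cartan Pi l i != 0, \sum_l c l * rs_cartan Pi l j = 0
    & \sum_l c l * rs_cartan Pi l k = 0].
Proof.
move=> ij ik.
have [p] : exists p, p \notin [set i; j; k].
  apply/existsP; apply: contraTT (N_ge5) => /existsPn all3.
  rewrite -ltnNge -[N]card_ord -cardsT.
  have -> : [set: 'I_N] = [set i; j; k].
    by apply/setP => p; rewrite inE; have := all3 p; rewrite negbK => ->.
  by rewrite cardsU cards2 cards1; case: (i != j); lia.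
rewrite !inE !negb_or -andbA => /and3P[pi pj pk].
(* Ordering [i] and [p] keeps the arc away from the step from [N - 1] to 0. *)
pose lo := minn i p; pose hi := maxn i p.
pose arc l := ((lo < l) && (l <= hi))%N.
pose sg : int := m%:Z - n%:Z; pose sg1 : int := \sum_(l | arc l) rs_sign l.
pose nu l : int := sg * (arc l)%:R - sg1.
(* The coefficients on the simple roots are the partial sums of coordinates. *)
pose c l : int := \sum_(q : 'I_N | (q <= l)%N) rs_sign q * nu q.
have total : \sum_q rs_sign q * nu q = 0.
  transitivity (sg * (\sum_q rs_sign q * (arc q)%:R) - sg1 * \sum_q rs_sign q).
    rewrite !mulr_sumr -sumrB; apply: eq_bigr => q _; rewrite /nu; ring.
  rewrite sum_rs_sign -/sg.
  have -> : \sum_q rs_sign q * (arc q)%:R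
    = sg1.
    rewrite /sg1 [RHS]big_mkcond; apply: eq_bigr => q _.
    by case: (arc q); rewrite ?mulr1 ?mulr0.
  by rewrite mulrC subrr.
have cS l : c l - c (ord_pred l) = rs_sign l * nu l.
  have [l' ->] : exists l', l = ordS l'.
    by exists (ord_pred l); rewrite ord_predK.
  rewrite ordSK; have := val_ordS l'; case: eqP => [lN|lN] vS.
    rewrite /c [X in _ - X](_ : _ = 0); last first.
      rewrite -[RHS]total; apply: eq_bigl => q; have := ltn_ord q; lia.
    rewrite subr0 (big_pred1 (ordS l')) // => q.
    by rewrite -[RHS]/(q == ordS l') ord_eqE vS leqn0.
  rewrite /c (bigD1 (ordS l')) // [X in _ + X - _](_ : _ = c l') ?addrK //.
  apply: eq_bigl => q; rewrite ord_eqE vS.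
  lia.
have val_c l : \sum_q c q * rs_cartan Pi q l = nu l - nu (ordS l).
  have := cS (ordS l); rewrite ordSK cartan_comb cS => ->.
  by rewrite !mulrA !rs_signK !mul1r.
have arcS l : l != i -> l != p -> arc (ordS l) = arc l.
  rewrite !ord_eqE => li lp; rewrite /arc.
  rewrite val_ordS; have := ltn_ord l; have := ltn_ord i; have := ltn_ord p.
  by case: eqP; rewrite /lo /hi; lia.
have arci : arc (ordS i) != arc i.
  rewrite /arc val_ordS; have := ltn_ord p; have := ltn_ord i.
  move: pi; rewrite ord_eqE.
  by case: (i.+1 =P N); rewrite /lo /hi; lia.
exists c; rewrite !val_c; split.
- rewrite /nu opprB addrA subrK -mulrBr mulf_neq0 //.
    by rewrite subr_eq0; apply/eqP; case.
  by move: arci; case: (arc _); case: (arc _).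
- by rewrite /nu arcS ?subrr // eq_sym.
- by rewrite /nu arcS ?subrr // eq_sym.
Qed.

Definition rs_affine_cartan : affine_cartan 'I_N :=
  {| ac_form := rs_cartan Pi; ac_odd := rs_odd Pi;
     ac_prev := @ord_pred N; ac_next := @ordS N;
     ac_sym := cartan_sym; ac_odd_isotropic := cartan_odd;
     ac_small := cartan_small; ac_prev_neq := ord_pred_neq;
     ac_next_neq := ordS_neq; ac_prev_next := ord_pred_neq_ordS;
     ac_nbr := fun i => ex_intro2 _ _ (ordS i) (ordS_neq i) (cartan_next i);
     ac_other_nbr := cartan_other; ac_separate := cartan_separate |}.

End RootSystem.

(** * Maps out of presented superalgebras *)

Section Lifts.
Variables (R : comNzRingType) (X : superGens) (A : superAlgType R).
Variable phi : X -> A.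

Local Notation F := (freeSAlg R X).

Definition word_lift (w : {fmonom X}) : A := \prod_(x <- (w : seq X)) phi x.

Fact word_lift_morphism : mmorphism word_lift.
Proof.
split=> [v w|]; last by rewrite /word_lift fm1 big_nil.
by rewrite /word_lift /mmul /= fmmulE big_cat.
Qed.

HB.instance Definition _ :=
  monalg.isMultiplicative.Build {fmonom X} A word_lift word_lift_morphism.

Definition free_lift (g : F) : A := mmap (in_alg A) word_lift g.

Fact free_lift_linear : linear free_lift.
Proof.
move=> c u v; rewrite /free_lift mmapD; congr (_ + _).
by rewrite (mmapZ (f := in_alg A) (h := word_lift)) -scalerAl mul1r.
Qed.

Fact free_lift_monoid : monoid_morphism free_lift.
Proof.
have cC (g : {malg R[{fmonom X}]}) m m' :
    GRing.comm (in_alg A (mcoeff m g)) (word_lift m').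
  by rewrite /GRing.comm /= -scalerAl -scalerAr mul1r mulr1.
have [mM m1] := commr_mmap_is_multiplicative cC.
by split.
Qed.

HB.instance Definition _ :=
  GRing.isLinear.Build R F A *:%R free_lift free_lift_linear.
HB.instance Definition _ :=
  GRing.isMonoidMorphism.Build F A free_lift free_lift_monoid.

Lemma free_lift_gen x : free_lift (free_gen R x) = phi x.
Proof.
rewrite /free_lift mmapU /= scale1r mul1r /word_lift fmuE.
by rewrite big_seq1.
Qed.

Lemma free_lift_spart : (forall x, homog (gpar x) (phi x)) ->
  forall p g, free_lift (spart p g) = spart p (free_lift g).
Proof.
move=> phi_homog.
have wh (w : {fmonom X}) : homog (wpar w) (word_lift w).
  rewrite /wpar /word_lift; elim: (w : seq X) => [|y l IH].
    by rewrite !big_nil; apply: homog1.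
  by rewrite !big_cons; apply: homogM.
have ph p g : homog p (free_lift (spart p g)).
  apply: homog_sum => w _ /=; rewrite -scalerAl mul1r.
  rewrite -[spart p g]/(free_part p g) free_part_coeff.
  by case: eqP => [<-|_]; [apply: homogZ | rewrite scale0r; apply: homog0].
move=> p g; rewrite -{2}(spart_sum g) linearD /= linearD /=.
rewrite !(homog_partE _ (ph _ _)).
by case: p; rewrite /= ?addr0 ?add0r.
Qed.

Lemma free_lift0 : free_lift 0 = 0.
Proof. exact: linear0. Qed.

Lemma free_liftB a b : free_lift (a - b) = free_lift a - free_lift b.
Proof. exact: linearB. Qed.

Lemma free_liftZ (c : R) a : free_lift (c *: a) = c *: free_lift a.
Proof. exact: linearZ. Qed.

Lemma free_liftM a b : free_lift (a * b) = free_lift a * free_lift b.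
Proof. exact: rmorphM. Qed.

Lemma free_lift_sum (I : Type) (s : seq I) (G : I -> F) :
  free_lift (\sum_(i <- s) G i) = \sum_(i <- s) free_lift (G i).
Proof. exact: linear_sum. Qed.

Lemma free_lift_unique (f : {lrmorphism F -> A}) :
  (forall x, f (free_gen R x) = phi x) -> f =1 free_lift.
Proof.
move=> f_gen g; have fw (w : {fmonom X}) : f (mkmalgU w 1) = word_lift w.
  case: w => l; elim: l => [|y l IH].
    have -> : mkmalgU (FMonom [::]) 1 = 1 :> F by rewrite -fmoneE.
    by rewrite rmorph1 /word_lift big_nil.
  have -> : mkmalgU (FMonom (y :: l)) 1
      = free_gen R y * mkmalgU (FMonom l) 1 :> F.
    rewrite /free_gen [RHS]malgM_def fgmulUU mulr1; congr mkmalgU.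
    by rewrite /mmul /= fmmulE fmuE.
  by rewrite rmorphM /= f_gen IH /word_lift big_cons.
have gE : g = \sum_(w <- msupp g) mcoeff w g *: (mkmalgU w 1 : F).
  rewrite {1}[g]monalgE; apply: eq_bigr => w _.
  by apply/malgP => v; rewrite mcoeffZ !mcoeffU mulr_natr.
rewrite {1}gE linear_sum /free_lift mmapE; apply: eq_bigr => w _.
by rewrite linearZ /= fw -scalerAl mul1r.
Qed.

End Lifts.

Section MorphismsOfSuperalgebras.
Variables (R : comNzRingType) (A B : superAlgType R).
Variable f : {lrmorphism A -> B}.
Hypothesis f_even : forall p a, f (spart p a) = spart p (f a).

Lemma morph_sbracket a b : f (sbracket a b) = sbracket (f a) (f b).
Proof.
rewrite /sbracket !big_bool /= ?expr0 ?expr1 !mul1r !mulN1r.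
by rewrite !(rmorphD, rmorphN, rmorphM) /= !f_even.
Qed.

Lemma morph_santibracket a b : f (santibracket a b) = santibracket (f a) (f b).
Proof.
rewrite /santibracket !big_bool /= ?expr0 ?expr1 !mul1r !mulN1r.
by rewrite !(rmorphD, rmorphN, rmorphM) /= !f_even.
Qed.

Lemma morph_comm a b : f (comm a b) = comm (f a) (f b).
Proof. by rewrite /comm rmorphB !rmorphM. Qed.

End MorphismsOfSuperalgebras.

Section LiftedBrackets.
Variables (R : comNzRingType) (X : superGens) (A : superAlgType R).
Variable phi : X -> A.
Hypothesis phi_homog : forall x, homog (gpar x) (phi x).
Local Notation f := (free_lift phi).
Let f_even := free_lift_spart phi_homog.
Implicit Types (a b c d : freeSAlg R X) (u v w z : A).

Lemma lift_bracket a b u v :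
  f a = u -> f b = v -> f (sbracket a b) = sbracket u v.
Proof. by move=> <- <-; refine (@morph_sbracket R _ _ f f_even a b). Qed.

Lemma lift_santibracketZ (k : R) a b u v : f a = u -> f b = v ->
  f (k *: santibracket a b) = k *: santibracket u v.
Proof.
move=> <- <-; rewrite -[santibracket (f a) (f b)]
  (@morph_santibracket R _ _ f f_even a b).
exact: free_liftZ.
Qed.

Lemma lift_bracketB a b c d u v w z :
    f a = u -> f b = v -> f c = w -> f d = z ->
  f (sbracket a b - sbracket c d) = sbracket u v - sbracket w z.
Proof.
move=> fa fb fc fd; rewrite -(lift_bracket fa fb) -(lift_bracket fc fd).
exact: free_liftB.
Qed.

Lemma lift_quartic a b c d u v w z :
    f a = u -> f b = v -> f c = w -> f d = z ->
  f (sbracket (sbracket a b) (sbracket c d))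
  = sbracket (sbracket u v) (sbracket w z).
Proof. by move=> fa fb fc fd; do 2!apply: lift_bracket. Qed.

Lemma lift_iter_bracket a b u v k : f a = u -> f b = v ->
  f (iter k (sbracket a) b) = iter k (sbracket u) v.
Proof. by move=> fa fb; elim: k => //= k IH; apply: lift_bracket. Qed.

Lemma lift_foldr_bracket (T : Type) (F : T -> freeSAlg R X) (G : T -> A)
    b v (l : seq T) : (forall k, f (F k) = G k) -> f b = v ->
  f (foldr (fun k => sbracket (F k)) b l)
  = foldr (fun k => sbracket (G k)) v l.
Proof. by move=> FG fb; elim: l => //= k l IH; apply: lift_bracket. Qed.

End LiftedBrackets.

Section QuotientLifts.
Variables (R : comNzRingType) (F A : superAlgType R) (r : homogRel F).
Variable f : {lrmorphism F -> A}.
Hypothesis f_rel : forall u v, r u v -> f u = f v.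

Lemma lift_ideal a : rel_ideal r a -> f a = 0.
Proof.
elim=> [|b c u v z /f_rel uv _ IH]; first exact: rmorph0.
by rewrite rmorphD /= IH addr0 !rmorphM rmorphB /= uv subrr mulr0 mul0r.
Qed.

Definition quot_lift (_ : forall u v, r u v -> f u = f v) (y : superQuot r) : A :=
  f (qrepr y).

Lemma quot_liftE a : quot_lift f_rel (qpi r a) = f a.
Proof.
by apply: subr0_eq; rewrite -rmorphB; apply/lift_ideal/qrepr_qpi.
Qed.

Fact quot_lift_linear : linear (quot_lift f_rel).
Proof.
move=> c u v; rewrite -[u]qreprK -[v]qreprK -linearZ -linearD /=.
by rewrite !quot_liftE linearP.
Qed.

Fact quot_lift_monoid : monoid_morphism (quot_lift f_rel).
Proof.
split=> [|u v]; first by rewrite -(rmorph1 (qpi r)) quot_liftE rmorph1.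
rewrite -[u]qreprK -[v]qreprK -rmorphM !quot_liftE; exact: rmorphM.
Qed.

HB.instance Definition _ :=
  GRing.isLinear.Build R (superQuot r) A *:%R (quot_lift f_rel)
    quot_lift_linear.
HB.instance Definition _ :=
  GRing.isMonoidMorphism.Build (superQuot r) A (quot_lift f_rel)
    quot_lift_monoid.

Lemma quot_lift_spart : (forall p a, f (spart p a) = spart p (f a)) ->
  forall p y, quot_lift f_rel (spart p y) = spart p (quot_lift f_rel y).
Proof. by move=> fp p y; rewrite -[y]qreprK spart_qpi !quot_liftE fp. Qed.

End QuotientLifts.

Section Projection.
Variables (R : comNzRingType) (A : superAlgType R) (q : homogRel A).

Lemma qpiB a b : qpi q (a - b) = qpi q a - qpi q b.
Proof. exact: linearB. Qed.

Lemma qpiZ (c : R) a : qpi q (c *: a) = c *: qpi q a.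
Proof. exact: linearZ. Qed.

Lemma qpiM a b : qpi q (a * b) = qpi q a * qpi q b.
Proof. exact: rmorphM. Qed.

Lemma qpi_sum (I : Type) (s : seq I) (F : I -> A) :
  qpi q (\sum_(i <- s) F i) = \sum_(i <- s) qpi q (F i).
Proof. exact: linear_sum. Qed.

Lemma homog_qpi p a : homog p a -> homog p (qpi q a).
Proof. by rewrite /homog spart_qpi => ->. Qed.

Lemma qpi_sbracket a b : qpi q (sbracket a b) = sbracket (qpi q a) (qpi q b).
Proof. by apply: morph_sbracket => p c; rewrite spart_qpi. Qed.

Lemma qpi_santibracket a b :
  qpi q (santibracket a b) = santibracket (qpi q a) (qpi q b).
Proof. by apply: morph_santibracket => p c; rewrite spart_qpi. Qed.

Lemma qpi_rel_bracket a b c :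
  q (sbracket a b) c -> sbracket (qpi q a) (qpi q b) = qpi q c.
Proof. by move/qpi_rel <-; rewrite qpi_sbracket. Qed.

Lemma qpi_rel_bracketB a b c d e f (k : R) :
    q (sbracket a b - sbracket c d) (k *: santibracket e f) ->
  sbracket (qpi q a) (qpi q b) - sbracket (qpi q c) (qpi q d)
  = k *: santibracket (qpi q e) (qpi q f).
Proof.
by move/qpi_rel; rewrite qpiB qpiZ !qpi_sbracket qpi_santibracket.
Qed.

Lemma qpi_rel_quartic a b c d e :
  q (sbracket (sbracket a b) (sbracket c d)) e ->
  sbracket (sbracket (qpi q a) (qpi q b)) (sbracket (qpi q c) (qpi q d))
  = qpi q e.
Proof. by move/qpi_rel <-; rewrite !qpi_sbracket. Qed.

Lemma qpi_iter_bracket a b k :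
  qpi q (iter k (sbracket a) b) = iter k (sbracket (qpi q a)) (qpi q b).
Proof. by elim: k => //= k IH; rewrite qpi_sbracket IH. Qed.

Lemma qpi_foldr_bracket (T : Type) a b (l : seq T) :
  qpi q (foldr (fun=> sbracket a) b l)
  = iter (size l) (sbracket (qpi q a)) (qpi q b).
Proof. by elim: l => //= k l IH; rewrite qpi_sbracket IH. Qed.

End Projection.

(** Two presentations define isomorphic superalgebras as soon as the generators
    of each can be sent to elements of the other algebra that satisfy its
    relations, in such a way that the two resulting homomorphisms are inverse to
    each other on generators; for the gradings to agree, it is enough that one
    of the two maps respects the parities. *)
Section PresentedIsomorphism.
Variables (R : comNzRingType) (X Y : superGens).
Variables (r : homogRel (freeSAlg R X)) (q : homogRel (freeSAlg R Y)).
Variables (phi : X -> superQuot q) (psi : Y -> superQuot r).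
Hypothesis phi_homog : forall x, homog (gpar x) (phi x).
Hypothesis phi_rel : forall u v, r u v -> free_lift phi u = free_lift phi v.
Hypothesis psi_rel : forall u v, q u v -> free_lift psi u = free_lift psi v.

Let f := @quot_lift R _ _ r (free_lift phi) phi_rel.
Let g := @quot_lift R _ _ q (free_lift psi) psi_rel.
Hypothesis fK : forall x, g (phi x) = qpi r (free_gen R x).
Hypothesis gK : forall y, f (psi y) = qpi q (free_gen R y).

Lemma presented_isomorphism : superalg_isomorphic (superQuot r) (superQuot q).
Proof.
have fE a : f (qpi r a) = free_lift phi a by exact: quot_liftE.
have gE a : g (qpi q a) = free_lift psi a by exact: quot_liftE.
have gf a : g (free_lift phi a) = qpi r a.
  transitivity (free_lift (g \o phi) a).
    apply: (free_lift_unique (f := g \o free_lift phi)) => x.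
    by rewrite /= free_lift_gen.
  apply/esym/(free_lift_unique (f := qpi r)) => x.
  by rewrite /= fK.
have fg a : f (free_lift psi a) = qpi q a.
  transitivity (free_lift (f \o psi) a).
    apply: (free_lift_unique (f := f \o free_lift psi)) => x.
    by rewrite /= free_lift_gen.
  apply/esym/(free_lift_unique (f := qpi q)) => x.
  by rewrite /= gK.
exists f; split; last exact/quot_lift_spart/free_lift_spart.
exists g => a; rewrite -[a]qreprK.
  exact: etrans (congr1 g (fE _)) (gf _).
exact: etrans (congr1 f (gE _)) (fg _).
Qed.

End PresentedIsomorphism.

(** * The two presentations *)

Section Isomorphism.
Variables (K : fieldType) (m n : nat) (Pi : simpleRootSystem m n).
Hypothesis intK_neq0 : forall k : int, k != 0 -> k%:~R != 0 :> K.
Hypotheses (m_ge2 : (2 <= m)%N) (n_ge2 : (2 <= n)%N) (m_neq_n : m <> n).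

Local Notation N := (m + n)%N.
Local Notation R := {poly K}.
Local Notation Ymin := (superYangian K Pi).
Local Notation Ydr := (drinfeldSuperYangian K Pi).
Local Notation C := (rs_affine_cartan Pi m_ge2 n_ge2 m_neq_n).
Local Notation odd := (rs_odd Pi).
Implicit Types i j k : 'I_N.

Definition half_hbar : R := 2^-1 *: 'X.
Local Notation eta := half_hbar.
Local Notation xcoef := (xcoef R C).

Lemma poly_int_unit (k : int) : k != 0 -> exists u : R, u * k%:~R = 1.
Proof.
move=> k0; exists ((k%:~R)^-1)%:P.
by rewrite -(rmorph_int polyC) -rmorphM mulVf ?intK_neq0 // rmorph1.
Qed.

(** ** Generators of the Drinfeld presentation *)

Definition dr_x s i r : Ydr := qpi (ydr_homogRel K Pi) (yx K Pi s i r).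
Definition dr_h i r : Ydr := qpi (ydr_homogRel K Pi) (yh K Pi i r).

Lemma homog_dr_x s i r : homog (odd i) (dr_x s i r).
Proof. exact/homog_qpi/homog_yx. Qed.

Lemma homog_dr_h i r : homog false (dr_h i r).
Proof. exact/homog_qpi/homog_yh. Qed.

Lemma dr_hh i j r t : comm (dr_h i r) (dr_h j t) = 0.
Proof.
have := qpi_rel_bracket (YDhh K Pi i j r t : ydr_homogRel K Pi _ _).
rewrite (sbracket_even (homog_dr_h _ _) (homog_dr_h _ _)) => ->.
exact: qpi0.
Qed.

Lemma dr_h0x s i j r : comm (dr_h i 0) (dr_x s j r) = xcoef s i j *: dr_x s j r.
Proof.
have := qpi_rel_bracket (YDh0x K Pi s i j r : ydr_homogRel K Pi _ _).
rewrite (sbracket_even (homog_dr_h _ _) (homog_dr_x _ _ _)) => ->.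
exact: qpiZ.
Qed.

Lemma dr_pairing i j r t : sbracket (dr_x false i r) (dr_x true j t)
  = if i == j then dr_h i (r + t)%N else 0.
Proof.
have := qpi_rel_bracket (YDxx_h K Pi i j r t : ydr_homogRel K Pi _ _).
by move=> ->; case: ifP => // _; apply: qpi0.
Qed.

Lemma dr_hx s i j r t :
  comm (dr_h i r.+1) (dr_x s j t) - comm (dr_h i r) (dr_x s j t.+1)
  = (xcoef s i j * eta) *: (dr_h i r * dr_x s j t + dr_x s j t * dr_h i r).
Proof.
have := qpi_rel_bracketB (YDhx K Pi s i j r t : ydr_homogRel K Pi _ _).
by rewrite !(sbracket_even (homog_dr_h _ _) (homog_dr_x _ _ _))
  (santibracket_even (homog_dr_h _ _) (homog_dr_x _ _ _)).
Qed.

Lemma dr_xx s i j r t :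
  sbracket (dr_x s i r.+1) (dr_x s j t) - sbracket (dr_x s i r) (dr_x s j t.+1)
  = (xcoef s i j * eta) *: santibracket (dr_x s i r) (dr_x s j t).
Proof.
exact: (qpi_rel_bracketB (YDxx K Pi s i j r t : ydr_homogRel K Pi _ _)).
Qed.

Lemma dr_serre0 s i j : i != j ->
  iter (1 + `|C i j|) (sbracket (dr_x s i 0)) (dr_x s j 0) = 0.
Proof.
move=> ij; set q := (1 + _)%N.
have := qpi_rel (YDserre K s (fun=> 0%N) 0 ij : ydr_homogRel K Pi _ _).
rewrite qpi_sum qpi0 (eq_bigr _ (fun sigma _ => qpi_foldr_bracket _ _ _ _)).
rewrite sumr_const size_enum_ord.
rewrite -scaler_nat => /(nat_scale_eq0 poly_int_unit); apply.
by apply/card_gt0P; exists 1%g.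
Qed.

Lemma dr_odd s i r t : odd i -> sbracket (dr_x s i r) (dr_x s i t) = 0.
Proof.
move=> oi; have := qpi_rel_bracket (YDodd K s r t oi : ydr_homogRel K Pi _ _).
by move=> ->; apply: qpi0.
Qed.

Lemma dr_quartic s i r t : odd i ->
  sbracket (sbracket (dr_x s (ord_pred i) r) (dr_x s i 0))
           (sbracket (dr_x s i 0) (dr_x s (ordS i) t)) = 0.
Proof.
move=> oi.
apply: etrans (qpi_rel_quartic (YDquartic K s r t oi : ydr_homogRel K Pi _ _)) _.
exact: qpi0.
Qed.

Lemma dr_shift s i j r :
  comm (dr_h i 1 - eta *: (dr_h i 0 * dr_h i 0)) (dr_x s j r)
  = xcoef s i j *: dr_x s j r.+1.
Proof.
apply/(first_log_coefficient _ _ (dr_h0x _ _ _ _) (dr_h0x _ _ _ _)).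
exact: dr_hx.
Qed.

(** ** Generators of the minimalistic presentation *)

Definition min_x s i (r : 'I_2) : Ymin :=
  qpi (ymin_homogRel K Pi) (yx K Pi s i r).
Definition min_h i (r : 'I_2) : Ymin :=
  qpi (ymin_homogRel K Pi) (yh K Pi i r).
Definition min_log i : Ymin := min_h i 1 - eta *: (min_h i 0 * min_h i 0).

Lemma homog_min_x s i r : homog (odd i) (min_x s i r).
Proof. exact/homog_qpi/homog_yx. Qed.

Lemma homog_min_h i r : homog false (min_h i r).
Proof. exact/homog_qpi/homog_yh. Qed.

Lemma min_logE i : qpi (ymin_homogRel K Pi) (yh1tilde K Pi i) = min_log i.
Proof. by rewrite /yh1tilde qpiB qpiZ expr2 qpiM. Qed.

Lemma homog_min_log i : homog false (min_log i).
Proof. by rewrite -min_logE; apply/homog_qpi/homog_yh1tilde. Qed.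

Lemma min_hh i j r t : comm (min_h i r) (min_h j t) = 0.
Proof.
have := qpi_rel_bracket (YMhh K Pi i j r t : ymin_homogRel K Pi _ _).
rewrite (sbracket_even (homog_min_h _ _) (homog_min_h _ _)) => ->.
exact: qpi0.
Qed.

Lemma min_log_comm i j : comm (min_log i) (min_log j) = 0.
Proof.
have h1 r k : comm (min_h k r) (min_log j) = 0.
  rewrite commBr commZr commMr !min_hh.
  by rewrite mul0r mulr0 addr0 scaler0 subrr.
rewrite commC commBr commZr commMr [comm (min_log j) (min_h i 1)]commC.
rewrite [comm (min_log j) (min_h i 0)]commC !h1.
by rewrite !oppr0 mul0r mulr0 addr0 scaler0 subr0 oppr0.
Qed.

Lemma min_log_x s i j :
  comm (min_log i) (min_x s j 0) = xcoef s i j *: min_x s j 1.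
Proof.
have := qpi_rel_bracket (YMh1x K Pi s i j : ymin_homogRel K Pi _ _).
rewrite min_logE.
rewrite (sbracket_even (homog_min_log _) (homog_min_x _ _ _)) => ->.
exact: qpiZ.
Qed.

(** Chosen so that the bracket with the logarithmic Cartan element of [ordS i],
    a node that is not orthogonal to [i], raises the degree without a factor. *)
Definition shift_coef (s : bool) i : R :=
  (-1) ^+ s * (((rs_cartan Pi (ordS i) i)%:~R : K)^-1)%:P.

Lemma shift_coefK s i : shift_coef s i * xcoef s (ordS i) i = 1.
Proof.
rewrite /shift_coef /xcoef /xsign mulrACA -expr2 sqrr_sign mul1r.
rewrite -(rmorph_int polyC) -rmorphM mulVf ?rmorph1 // intK_neq0 //.
exact: cartan_next.
Qed.

Fixpoint cur_x s i (r : nat) : Ymin :=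
  if r is r'.+1 then shift_coef s i *: comm (min_log (ordS i)) (cur_x s i r')
  else min_x s i 0.

Lemma cur_xS s i r :
  cur_x s i r.+1 = shift_coef s i *: comm (min_log (ordS i)) (cur_x s i r).
Proof. by []. Qed.

Lemma homog_cur_x s i r : homog (odd i) (cur_x s i r).
Proof.
elim: r => [|r IH]; first exact: homog_min_x.
rewrite cur_xS; exact/homogZ/(homog_comm (homog_min_log _) IH).
Qed.

Lemma cur_x1 s i : cur_x s i 1 = min_x s i 1.
Proof. by rewrite cur_xS min_log_x scalerA shift_coefK scale1r. Qed.

Lemma cur_x_ord s i (r : 'I_2) : cur_x s i r = min_x s i r.
Proof.
case: r => [[|[|r]] lr] //.
  by rewrite /=; congr min_x; apply: val_inj.
by rewrite [LHS]cur_x1; congr min_x; apply: val_inj.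
Qed.

(** All logarithmic Cartan elements raise the degree, not only the one used in
    the definition, because they commute with one another. *)
Lemma cur_shift s i j r :
  comm (min_log i) (cur_x s j r) = xcoef s i j *: cur_x s j r.+1.
Proof.
elim: r => [|r IH]; first by rewrite cur_x1; apply: min_log_x.
exact: (comm_eigen_shift _ (min_log_comm _ _) IH).
Qed.

Local Notation cur_h := (cartan_current cur_x).

Lemma cur_h0 i : cur_h i 0 = min_h i 0.
Proof.
have := qpi_rel_bracket (YMx0x0 K Pi i i : ymin_homogRel K Pi _ _).
by rewrite eqxx.
Qed.

Lemma cur_h1 i : cur_h i 1 = min_h i 1.
Proof.
have := qpi_rel_bracket (YMx1x0 K Pi i i : ymin_homogRel K Pi _ _).
rewrite eqxx => e; rewrite /cartan_current /pairing cur_x1; exact: e.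
Qed.

Lemma cur_h_ord i (r : 'I_2) : cur_h i r = min_h i r.
Proof.
case: r => [[|[|r]] lr] //.
  by rewrite [LHS]cur_h0; congr min_h; apply: val_inj.
by rewrite [LHS]cur_h1; congr min_h; apply: val_inj.
Qed.

Lemma cur_log i : log_cartan eta cur_x i = min_log i.
Proof. by rewrite /log_cartan cur_h0 cur_h1. Qed.

Lemma cur_minimal : minimal_currents C eta cur_x.
Proof.
split.
- exact: homog_cur_x.
- by move=> i j [|[|r]] [|[|t]] // _ _; rewrite ?cur_h0 ?cur_h1 min_hh.
- move=> i j /negPf ij.
  have := qpi_rel_bracket (YMx0x0 K Pi i j : ymin_homogRel K Pi _ _).
  by rewrite ij => ->; apply: qpi0.
- move=> i; rewrite cur_h1 /pairing cur_x1.
  have := qpi_rel_bracket (YMx0x1 K Pi i i : ymin_homogRel K Pi _ _).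
  by rewrite eqxx.
- move=> s i j; rewrite cur_h0.
  have := qpi_rel_bracket (YMh0x K Pi s i j 0 : ymin_homogRel K Pi _ _).
  rewrite (sbracket_even (homog_min_h _ _) (homog_min_x _ _ _)) => ->.
  exact: qpiZ.
- by move=> s i j r; rewrite cur_log cur_shift.
- move=> s i j; rewrite !cur_x1.
  exact: (qpi_rel_bracketB (YMxx K Pi s i j : ymin_homogRel K Pi _ _)).
- move=> s i j ij.
  have := qpi_rel (YMserre K Pi s ij : ymin_homogRel K Pi _ _).
  by rewrite qpi0 qpi_iter_bracket.
- move=> s i oi; have := qpi_rel_bracket (YModd K s oi : ymin_homogRel K Pi _ _).
  by move=> ->; apply: qpi0.
- move=> s i oi; 
  apply: etrans (qpi_rel_quartic (YMquartic K s oi : ymin_homogRel K Pi _ _)) _.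
  exact: qpi0.
Qed.

(** ** The isomorphism *)

Definition min_to_dr (g : ygens Pi 'I_2) : Ydr :=
  match g with
  | inl (s, i, r) => dr_x s i r
  | inr (i, r) => dr_h i r
  end.

Definition dr_to_min (g : ygens Pi nat) : Ymin :=
  match g with
  | inl (s, i, r) => cur_x s i r
  | inr (i, r) => cur_h i r
  end.

Lemma homog_min_to_dr g : homog (gpar g) (min_to_dr g).
Proof. by case: g => [[[s i] r]|[i r]]; [apply: homog_dr_x | apply: homog_dr_h]. Qed.

Lemma homog_dr_to_min g : homog (gpar g) (dr_to_min g).
Proof.
case: g => [[[s i] r]|[i r]]; first exact: homog_cur_x.
exact: (homog_current cur_minimal).
Qed.

Local Notation phi := (free_lift min_to_dr).
Local Notation psi := (free_lift dr_to_min).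

Let phi_spart := free_lift_spart homog_min_to_dr.

Lemma phi_x s i r : phi (yx K Pi s i r) = dr_x s i r.
Proof. exact: free_lift_gen. Qed.
Lemma phi_h i r : phi (yh K Pi i r) = dr_h i r.
Proof. exact: free_lift_gen. Qed.
Lemma psi_x s i r : psi (yx K Pi s i r) = cur_x s i r.
Proof. exact: free_lift_gen. Qed.
Lemma psi_h i r : psi (yh K Pi i r) = cur_h i r.
Proof. exact: free_lift_gen. Qed.

Lemma phi_log i :
  phi (yh1tilde K Pi i) = dr_h i 1 - eta *: (dr_h i 0 * dr_h i 0).
Proof.
by rewrite /yh1tilde free_liftB free_liftZ expr2 free_liftM 2!phi_h.
Qed.

Let liftM := lift_bracket homog_min_to_dr.
Let liftD := lift_bracket homog_dr_to_min.

Lemma drinfeld_satisfies_minimal u v : ymin_rel u v -> phi u = phi v.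
Proof.
case=> {u v} [i j r t|i j|i j|i j|s i j r|s i j|s i j|s i j ij|s i oi|s i oi].
- apply: etrans (liftM (phi_h _ _) (phi_h _ _)) _; rewrite free_lift0.
  by rewrite (sbracket_even (homog_dr_h _ _) (homog_dr_h _ _)) dr_hh.
- apply: etrans (liftM (phi_x _ _ _) (phi_x _ _ _)) _; rewrite dr_pairing.
  by case: ifP; rewrite ?phi_h ?free_lift0.
- apply: etrans (liftM (phi_x _ _ _) (phi_x _ _ _)) _; rewrite dr_pairing.
  by case: ifP; rewrite ?phi_h ?free_lift0.
- apply: etrans (liftM (phi_x _ _ _) (phi_x _ _ _)) _; rewrite dr_pairing.
  by case: ifP; rewrite ?phi_h ?free_lift0.
- apply: etrans (liftM (phi_h _ _) (phi_x _ _ _)) _; rewrite free_liftZ phi_x.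
  by rewrite (sbracket_even (homog_dr_h _ _) (homog_dr_x _ _ _)) dr_h0x.
- apply: etrans (lift_bracketB homog_min_to_dr (phi_x _ _ _) (phi_x _ _ _)
    (phi_x _ _ _) (phi_x _ _ _)) _.
  apply: etrans (dr_xx s i j 0 0) _; apply: esym.
  exact: (lift_santibracketZ homog_min_to_dr _ (phi_x _ _ _) (phi_x _ _ _)).
- apply: etrans (liftM (phi_log _) (phi_x _ _ _)) _; rewrite free_liftZ phi_x.
  rewrite -(dr_shift s i j 0); apply: sbracket_even; last exact: homog_dr_x.
  apply: homogB; first exact: homog_dr_h.
  apply: homogZ; exact: (homogM (homog_dr_h _ _) (homog_dr_h _ _)).
- apply: etrans (lift_iter_bracket homog_min_to_dr _ (phi_x _ _ _)
    (phi_x _ _ _)) _.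
  by rewrite free_lift0; apply: dr_serre0.
- apply: etrans (liftM (phi_x _ _ _) (phi_x _ _ _)) _; rewrite free_lift0.
  exact: dr_odd.
- apply: etrans (lift_quartic homog_min_to_dr (phi_x _ _ _) (phi_x _ _ _)
    (phi_x _ _ _) (phi_x _ _ _)) _.
  by rewrite free_lift0; apply: dr_quartic.
Qed.

Lemma minimal_satisfies_drinfeld u v : ydr_rel u v -> psi u = psi v.
Proof.
have M := cur_minimal.
case=> {u v} [i j r t|s i j r|i j r t|s i j r t|s i j r t|s i j r t ij
  |s i r t oi|s i r t oi].
- apply: etrans (liftD (psi_h _ _) (psi_h _ _)) _; rewrite free_lift0.
  exact: (sbracket_currents poly_int_unit M).
- apply: etrans (liftD (psi_h _ _) (psi_x _ _ _)) _; rewrite free_liftZ psi_x.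
  apply: etrans (sbracket_current M _ _ _ _ _) _.
  exact: (comm_current0 poly_int_unit M).
- apply: etrans (liftD (psi_x _ _ _) (psi_x _ _ _)) _.
  case: eqP => [<-|/eqP ij].
    by rewrite psi_h; apply: (pairingE poly_int_unit M).
  by rewrite free_lift0; apply: (x_opposite_nodes poly_int_unit M).
- apply: etrans (lift_bracketB homog_dr_to_min (psi_h _ _) (psi_x _ _ _)
    (psi_h _ _) (psi_x _ _ _)) _.
  apply: etrans (sbracket_current_relation poly_int_unit M _ _ _ _ _) _.
  apply: esym.
  exact: (lift_santibracketZ homog_dr_to_min _ (psi_h _ _) (psi_x _ _ _)).
- apply: etrans (lift_bracketB homog_dr_to_min (psi_x _ _ _) (psi_x _ _ _)
    (psi_x _ _ _) (psi_x _ _ _)) _.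
  apply: etrans (xx_bracket_relation poly_int_unit M _ _ _ _ _) _.
  apply: esym.
  exact: (lift_santibracketZ homog_dr_to_min _ (psi_x _ _ _) (psi_x _ _ _)).
- rewrite free_lift0 -[RHS](symmetrized_serre poly_int_unit M s r t ij).
  apply: etrans (free_lift_sum _ _ _) _; apply: eq_bigr => sigma _.
  exact: (lift_foldr_bracket homog_dr_to_min
    (F := fun q => yx K Pi s i (r (sigma q)))
    (G := fun q => cur_x s i (r (sigma q))) _
    (fun q => psi_x _ _ _) (psi_x _ _ _)).
- apply: etrans (liftD (psi_x _ _ _) (psi_x _ _ _)) _; rewrite free_lift0.
  exact: (odd_nilpotent poly_int_unit M).
- apply: etrans (lift_quartic homog_dr_to_min (psi_x _ _ _) (psi_x _ _ _)
    (psi_x _ _ _) (psi_x _ _ _)) _.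
  by rewrite free_lift0; apply: (quartic_serre poly_int_unit M).
Qed.

Lemma yangian_presentations_isomorphic : superalg_isomorphic Ymin Ydr.
Proof.
apply: (@presented_isomorphism R _ _ (ymin_homogRel K Pi) (ydr_homogRel K Pi)
  min_to_dr dr_to_min homog_min_to_dr
  drinfeld_satisfies_minimal minimal_satisfies_drinfeld).
- case=> [[[s i] r]|[i r]].
    apply: etrans (quot_liftE (r := ydr_homogRel K Pi)
      minimal_satisfies_drinfeld _) _.
    exact: etrans (psi_x _ _ _) (cur_x_ord _ _ _).
  apply: etrans (quot_liftE (r := ydr_homogRel K Pi)
      minimal_satisfies_drinfeld _) _.
  exact: etrans (psi_h _ _) (cur_h_ord _ _).
pose f : {lrmorphism Ymin -> Ydr} :=
  quot_lift (r := ymin_homogRel K Pi) drinfeld_satisfies_minimal.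
have f_spart : forall p a, f (spart p a) = spart p (f a).
  exact/quot_lift_spart/phi_spart.
have fx s i r : f (cur_x s i r) = dr_x s i r.
  have flog k : f (min_log k) = dr_h k 1 - eta *: (dr_h k 0 * dr_h k 0).
    rewrite -min_logE.
    apply: etrans (quot_liftE (r := ymin_homogRel K Pi)
      drinfeld_satisfies_minimal _) _.
    exact: phi_log.
  elim: r => [|r IH].
    exact: etrans (quot_liftE (r := ymin_homogRel K Pi)
      drinfeld_satisfies_minimal _) (phi_x _ _ _).
  have -> : f (cur_x s i r.+1)
      = shift_coef s i *: comm (f (min_log (ordS i))) (f (cur_x s i r)).
    by rewrite cur_xS linearZ; congr (_ *: _); apply: morph_comm.
  by rewrite flog IH dr_shift scalerA shift_coefK scale1r.
case=> [[[s i] r]|[i r]]; first exact: fx.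
apply: etrans (morph_sbracket f_spart _ _) _.
by rewrite fx fx dr_pairing eqxx addn0.
Qed.

End Isomorphism.

Theorem theorem6p1 (R : realType) (m n : nat)
    (m_ge2 : (2 <= m)%N) (n_ge2 : (2 <= n)%N) (m_neq_n : m <> n)
    (Pi : simpleRootSystem m n) :
  superalg_isomorphic (superYangian (complex R) Pi)
                      (drinfeldSuperYangian (complex R) Pi).
Proof.
by apply: yangian_presentations_isomorphic => // k k0; rewrite intr_eq0.
Qed.
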